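(* For any associative ring $R$, the following conditions are equivalent: (1) in any acyclic complex of right $R$-modules with fp-projective terms, the modules of cocycles are fp-projective; (2) any $\mathsf{FpProj}$-periodic right $R$-module is fp-projective, where $\mathsf{FpProj}$ denotes the class of all fp-projective right $R$-modules; (3) the ring $R$ is right coherent.
   Context: Rings are associative and unital. Complexes are $\mathbb Z$-indexed and may be unbounded in both directions. A right $R$-module $J$ is fp-injective if $\operatorname{Ext}^1_R(T,J)=0$ for all finitely presented right $R$-modules $T$. A right $R$-module $P$ is fp-projective if $\operatorname{Ext}^1_R(P,J)=0$ for all fp-injective right $R$-modules $J$. For a class of modules $\mathsf A$, a module $M$ is $\mathsf A$-periodic if there is a short exact sequence $0\to M\to A\to M\to 0$ with $A\in\mathsf A$. A ring is right coherent if every finitely generated right ideal is finitely presented. *)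

(* Defs.v *)
From HB Require Import structures.
From mathcomp Require Import all_boot all_order all_algebra.

Set Implicit Arguments.
Unset Strict Implicit.
Unset Printing Implicit Defensive.

Import GRing.Theory.
Local Open Scope ring_scope.

(* Everything is written for left modules over [S : pzRingType] (an arbitrary
   unital associative ring, the zero ring included).  A right [R]-module is a
   left module over the converse ring, i.e. an inhabitant of [lmodType R^c]. *)

(* A submodule, given by its membership predicate, as a module in its own
   right. *)
Record submod (S : pzRingType) (V : lmodType S) (U : submodClosed V) :=
  Submod { submod_val : V; _ : submod_val \in U }.

HB.instance Definition _ S V U := [isSub for @submod_val S V U].
HB.instance Definition _ S (V : lmodType S) (U : submodClosed V) :=
  [Choice of submod U by <:].
HB.instance Definition _ S (V : lmodType S) (U : submodClosed V) :=
  [SubChoice_isSubLmodule of submod U by <:].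

Definition kernel (S : pzRingType) (V W : lmodType S) (f : {linear V -> W}) :
  {pred V} := [pred x | f x == 0].

Fact kernel_submod_closed (S : pzRingType) (V W : lmodType S)
  (f : {linear V -> W}) : submod_closed (kernel f).
Proof.
split=> [|a x y]; rewrite !inE ?linear0 // => /eqP fx0 /eqP fy0.
by rewrite linearP fx0 fy0 scaler0 addr0.
Qed.

HB.instance Definition _ (S : pzRingType) (V W : lmodType S)
    (f : {linear V -> W}) :=
  GRing.isSubmodClosed.Build S V (kernel f) (kernel_submod_closed f).

Definition surjective (A B : Type) (f : A -> B) := forall y, exists x, f x = y.

Definition finitely_generated (S : pzRingType) (M : lmodType S) : Prop :=
  exists (n : nat) (f : {linear 'rV[S]_n -> M}), surjective f.

Definition finitely_presented (S : pzRingType) (M : lmodType S) : Prop :=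
  exists (n : nat) (f : {linear 'rV[S]_n -> M}),
    surjective f /\ finitely_generated (submod (kernel f)).

Definition right_coherent (R : pzRingType) : Prop :=
  forall I : submodClosed (R^c)^o,
    finitely_generated (submod I) -> finitely_presented (submod I).

Definition short_exact (S : pzRingType) (A B C : lmodType S)
    (i : {linear A -> B}) (p : {linear B -> C}) : Prop :=
  [/\ injective i,
      (forall b : B, p b = 0 <-> exists a : A, i a = b)
    & surjective p].

Record extension (S : pzRingType) (T J : lmodType S) := Extension {
  ext_mid : lmodType S;
  ext_in : {linear J -> ext_mid};
  ext_out : {linear ext_mid -> T};
  ext_exact : short_exact ext_in ext_out }.

(* Such an [h] is automatically bijective, by the five lemma. *)
Definition extension_equiv (S : pzRingType) (T J : lmodType S)
    (X Y : extension T J) : Prop :=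
  exists h : {linear ext_mid X -> ext_mid Y},
    (forall j : J, h (ext_in X j) = ext_in Y j) /\
    (forall e : ext_mid X, ext_out Y (h e) = ext_out X e).

Definition pair_in (S : pzRingType) (T J : lmodType S) (j : J) :
  (J * T)%type := (j, 0).

Fact pair_in_linear (S : pzRingType) (T J : lmodType S) :
  linear (@pair_in S T J).
Proof. by move=> a x y; congr pair; rewrite /= scaler0 addr0. Qed.

HB.instance Definition _ (S : pzRingType) (T J : lmodType S) :=
  GRing.isLinear.Build S J (J * T)%type *:%R (@pair_in S T J)
    (@pair_in_linear S T J).

Definition pair_out (S : pzRingType) (T J : lmodType S) :
  {linear (J * T)%type -> T} := snd.

Fact split_exact (S : pzRingType) (T J : lmodType S) :
  short_exact (@pair_in S T J) (@pair_out S T J).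
Proof.
split=> [x y [] // | [j t] | t]; last by exists (0, t).
by split=> /= [-> | [a [_ <-]]] //; exists j.
Qed.

Definition split_extension (S : pzRingType) (T J : lmodType S) :
  extension T J := Extension (@split_exact S T J).

(* Vanishing of the Yoneda group Ext^1(T, J) of extensions of [T] by [J] up to
   equivalence, whose zero is the class of the split extension. *)
Definition Ext1_eq0 (S : pzRingType) (T J : lmodType S) : Prop :=
  forall X : extension T J, extension_equiv X (split_extension T J).

Definition fp_injective (S : pzRingType) (J : lmodType S) : Prop :=
  forall T : lmodType S, finitely_presented T -> Ext1_eq0 T J.

Definition fp_projective (S : pzRingType) (P : lmodType S) : Prop :=
  forall J : lmodType S, fp_injective J -> Ext1_eq0 P J.

Definition periodic (S : pzRingType) (A : lmodType S -> Prop)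
    (M : lmodType S) : Prop :=
  exists (N : lmodType S) (i : {linear M -> N}) (p : {linear N -> M}),
    A N /\ short_exact i p.

Record complex (S : pzRingType) := Complex {
  cx_term :> int -> lmodType S;
  cx_diff : forall n : int, {linear cx_term n -> cx_term (n + 1)};
  cx_diff_diff : forall (n : int) (x : cx_term n), cx_diff (n + 1) (cx_diff n x) = 0 }.

Definition cocycles (S : pzRingType) (C : complex S) (n : int) : lmodType S :=
  submod (kernel (cx_diff C n)).

(* Exactness at degree [n + 1]; every integer has this form. *)
Definition acyclic (S : pzRingType) (C : complex S) : Prop :=
  forall (n : int) (x : C (n + 1)),
    cx_diff C (n + 1) x = 0 -> exists y : C n, cx_diff C n y = x.

(* Main.v *)
(* Fp-projectivity of T is used as a lifting property against surjections with
   fp-injective kernel.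

   (1) => (2): splice 0 -> M -> N -> M -> 0 with itself.  (2) => (1): the direct
   sum of all cocycle modules of an acyclic complex is periodic over the direct
   sum of its terms.

   (2) => (3): for a finitely generated ideal K of S, the same direct sum trick
   applied to a resolution of S / K shows that K is fp-projective.  Let L be the
   kernel of a surjection S^n -> K, and embed L in an fp-injective module F
   obtained by attaching finitely presented cells to L.  The embedding extends
   to S^n, whose image involves only finitely many cells; these are glued along
   a finitely generated submodule of L, which must then be the whole of L.

   (3) => (2): an fp-projective N is a retract of a module F built by attaching
   finitely presented cells.  For a set A of cells closed under attaching maps,
   coherence makes the kernel of every map S^n -> F / span A finitely generated
   (the Hill lemma).  If 0 -> M -> N -> M -> 0 is exact, then by countable
   closing-off M is a union of submodules M_A = M /\ span A, for A closed and
   compatible with both maps and with the retraction.  A section over M_A of an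
   extension of M by an fp-injective module extends to some larger M_A' through
   countably many finitely generated steps, each of them unobstructed because
   the relations are finitely generated; Zorn's lemma concludes. *)

Require Import Defs.
From HB Require Import structures.
From mathcomp Require Import all_boot all_order all_algebra.
From mathcomp Require Import boolp classical_sets.

Set Implicit Arguments.
Unset Strict Implicit.
Unset Printing Implicit Defensive.

Import GRing.Theory.
Local Open Scope ring_scope.

(** * Submodules as predicates *)

Section Submodules.
Variable S : pzRingType.
Implicit Types V W X : lmodType S.

Definition issub V (U : V -> Prop) :=
  U 0 /\ forall (a : S) x y, U x -> U y -> U (a *: x + y).

Section IsSub.
Variables (V : lmodType S) (U : V -> Prop).
Hypothesis hU : issub U.

Lemma issub0 : U 0. Proof. by case: hU. Qed.

Lemma issubD x y : U x -> U y -> U (x + y).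
Proof. by case: hU => _ h Ux Uy; rewrite -[x]scale1r; exact: h. Qed.

Lemma issubZ a x : U x -> U (a *: x).
Proof. by case: hU => h0 h Ux; rewrite -[_ *: _]addr0; exact: h. Qed.

Lemma issubN x : U x -> U (- x).
Proof. by rewrite -scaleN1r; exact: issubZ. Qed.

Lemma issubB x y : U x -> U y -> U (x - y).
Proof. by move=> Ux /issubN; exact: issubD. Qed.

Lemma issub_sum (I : Type) (r : seq I) (P : pred I) (F : I -> V) :
  (forall i, P i -> U (F i)) -> U (\sum_(i <- r | P i) F i).
Proof. by move=> UF; apply: big_ind => //; [exact: issub0|exact: issubD]. Qed.

Definition submod_pred : {pred V} := fun x => `[< U x >].

Fact submod_pred_closed : submod_closed submod_pred.
Proof.
split=> [|a x y]; first by apply/asboolP; exact: issub0.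
by move=> /asboolP Ux /asboolP Uy; apply/asboolP; case: hU => _; apply.
Qed.

Definition submod_of : submodClosed V :=
  HB.pack submod_pred
    (GRing.isSubmodClosed.Build S V submod_pred submod_pred_closed).

Lemma submod_ofP x : reflect (U x) (x \in submod_of).
Proof. exact: asboolP. Qed.

End IsSub.

Lemma issub_preim V W (f : {linear V -> W}) (U : W -> Prop) :
  issub U -> issub (fun x => U (f x)).
Proof.
move=> [U0 UD]; split; first by rewrite linear0.
by move=> a x y Ux Uy; rewrite linearP; exact: UD.
Qed.

Lemma issub_im V W (f : {linear V -> W}) (U : V -> Prop) :
  issub U -> issub (fun y => exists2 x, U x & f x = y).
Proof.
move=> [U0 UD]; split; first by exists 0; rewrite ?linear0.
move=> a _ _ [x Ux <-] [y Uy <-]; exists (a *: x + y); first exact: UD.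
by rewrite linearP.
Qed.

Lemma issub_add V (U W : V -> Prop) :
  issub U -> issub W -> issub (fun x => exists2 w, W w & U (x - w)).
Proof.
move=> hU hW; split.
  by exists 0; [exact: issub0|rewrite subr0; exact: issub0].
move=> a x y [w Ww Uw] [z Wz Uz]; exists (a *: w + z); first exact: hW.2.
rewrite opprD addrACA -scalerBr; exact: hU.2.
Qed.

Lemma issub_ker V : issub (fun x : V => x = 0).
Proof. by split=> // a x y -> ->; rewrite scaler0 addr0. Qed.

Lemma issub_range V W (f : {linear V -> W}) :
  issub (fun y => exists x, f x = y).
Proof.
split; first by exists 0; rewrite linear0.
by move=> a _ _ [x <-] [y <-]; exists (a *: x + y); rewrite linearP.
Qed.

Definition mklin V W (f : V -> W) (hf : linear f) : {linear V -> W} :=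
  HB.pack f (GRing.isLinear.Build S V W *:%R f hf).

Lemma mklinE V W (f : V -> W) (hf : linear f) x : mklin hf x = f x.
Proof. by []. Qed.

Definition rel_linear V W (r : V -> W -> Prop) :=
  r 0 0 /\ forall (a : S) x x' y y',
    r x y -> r x' y' -> r (a *: x + x') (a *: y + y').

(** Subtraction carries uniqueness from [0] to every argument, so the chosen values are forced and
    hence linear. *)
Lemma linear_of_rel V W (r : V -> W -> Prop) :
  rel_linear r -> (forall x, exists y, r x y) -> (forall y, r 0 y -> y = 0) ->
  exists g : {linear V -> W}, forall x, r x (g x).
Proof.
move=> [r0 rD] tot fn; have [g hg] := choice tot.
have uniq x y y' : r x y -> r x y' -> y = y'.
  move=> h h'; apply/eqP; rewrite -subr_eq0; apply/eqP/fn.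
  have := rD (-1) _ _ _ _ h' h; rewrite !scaleN1r addNr.
  by rewrite addrC.
have lg : linear g.
  by move=> a x y; apply: (uniq (a *: x + y)) => //; exact: rD.
by exists (mklin lg).
Qed.

Lemma rel_linear_eq V W X (f : {linear V -> X}) (g : {linear W -> X})
  (U : X -> Prop) : issub U -> rel_linear (fun x y => U (f x - g y)).
Proof.
move=> hU; split=> /=; first by rewrite !linear0 addr0; exact: issub0.
move=> a x x' y y' h h'; rewrite !linearP addrACA -scalerDr.
exact: hU.2.
Qed.

(** Values are chosen on the standard basis only; by freeness the relation need not be
    single-valued. *)
Lemma free_sel n V (r : 'rV[S]_n -> V -> Prop) :
  rel_linear r -> (forall x, exists y, r x y) ->
  exists g : {linear 'rV[S]_n -> V}, forall x, r x (g x).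
Proof.
move=> [r0 rD] tot; have [u hu] := choice (fun i : 'I_n => tot (delta_mx 0 i)).
pose g (x : 'rV[S]_n) := \sum_i x 0 i *: u i.
have lg : linear g.
  move=> a x y; rewrite /g scaler_sumr -big_split; apply: eq_bigr => i _ /=.
  by rewrite !mxE scalerDl scalerA.
exists (mklin lg) => x; rewrite mklinE {1}[x]row_sum_delta /g.
apply: (big_rec2 (fun y x => r x y)) => // i y1 y2 _; exact: rD.
Qed.

Lemma free_lift n V W (f : {linear 'rV[S]_n -> W}) (p : {linear V -> W}) :
  surjective p -> exists g : {linear 'rV[S]_n -> V}, forall x, p (g x) = f x.
Proof.
move=> sur_p; have [||g hg] := @free_sel n V (fun x y => f x - p y = 0).
- exact: (rel_linear_eq _ _ (issub_ker W)).
- by move=> x; have [y <-] := sur_p (f x); exists y; rewrite subrr.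
by exists g => x; apply/esym/eqP; rewrite -subr_eq0 hg.
Qed.

Lemma factor_surj V W X (q : {linear V -> W}) (f : {linear V -> X}) :
  surjective q -> (forall x, q x = 0 -> f x = 0) ->
  exists g : {linear W -> X}, forall x, g (q x) = f x.
Proof.
move=> sq h.
have [||y [x qx <-]|g hg] := @linear_of_rel W X
  (fun w y => exists2 x, q x = w & f x = y).
- split; first by exists 0; rewrite linear0.
  move=> a _ _ _ _ [x <- <-] [y <- <-].
  by exists (a *: x + y); rewrite linearP.
- by move=> w; have [x <-] := sq w; exists (f x); exists x.
- exact: h.
exists g => x; have [y qy <-] := hg (q x).
apply/eqP; rewrite -subr_eq0 -linearB; apply/eqP/h.
by rewrite linearB /= qy subrr.
Qed.

Lemma factor_inj V W X (i : {linear W -> X}) (f : {linear V -> X}) :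
  injective i -> (forall x, exists y, i y = f x) ->
  exists g : {linear V -> W}, forall x, i (g x) = f x.
Proof.
move=> inji h.
have [||y|g hg] := @linear_of_rel V W (fun v y => i y = f v).
- split; first by rewrite !linear0.
  by move=> a x x' y y' h1 h2; rewrite !linearP h1 h2.
- exact: h.
- by rewrite linear0 => hy; apply: inji; rewrite hy linear0.
by exists g.
Qed.

Lemma linear_inj V W (f : {linear V -> W}) :
  (forall x, f x = 0 -> x = 0) -> injective f.
Proof.
move=> h x y fxy; apply/eqP; rewrite -subr_eq0; apply/eqP/h.
by rewrite linearB fxy subrr.
Qed.

(** * Quotient modules *)

Section Quotient.
Variables (V : lmodType S) (U : V -> Prop) (hU : issub U).

Fact submod_pred_zmod_closed : zmod_closed (submod_pred U).
Proof.
split=> [|x y /asboolP Ux /asboolP Uy]; apply/asboolP; first exact: issub0.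
exact: issubB.
Qed.

Definition zmod_of : zmodClosed V :=
  HB.pack (submod_pred U)
    (GRing.isZmodClosed.Build V (submod_pred U) submod_pred_zmod_closed).

Definition quotm := Quotient.quot zmod_of.
HB.instance Definition _ := GRing.Zmodule.on quotm.
Local Open Scope quotient_scope.

(** The scalar action goes through chosen representatives of the additive quotient; [quotm_scale_pi]
    shows independence of the choice. *)
Definition quotm_scale (a : S) (x : quotm) : quotm := \pi_quotm (a *: repr x).

Lemma quotm_scale_pi a x : quotm_scale a (\pi_quotm x) = \pi_quotm (a *: x).
Proof.
apply/eqP; rewrite /quotm_scale -Quotient.idealrBE -scalerBr.
apply/asboolP/(issubZ hU)/asboolP.
by have /eqP := reprK (\pi_quotm x); rewrite -Quotient.idealrBE.
Qed.

Fact quotm_scaleA a b x :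
  quotm_scale a (quotm_scale b x) = quotm_scale (a * b) x.
Proof. by rewrite -[x]reprK !quotm_scale_pi scalerA ?reprK. Qed.

Fact quotm_scale1 : left_id 1 quotm_scale.
Proof. by move=> x; rewrite -[x]reprK !quotm_scale_pi scale1r. Qed.

Fact quotm_scaleDr : right_distributive quotm_scale +%R.
Proof.
move=> a x y; rewrite -[x]reprK -[y]reprK -raddfD !quotm_scale_pi.
by rewrite -raddfD scalerDr.
Qed.

Fact quotm_scaleDl x : {morph quotm_scale^~ x : a b / a + b}.
Proof.
by move=> a b /=; rewrite -[x]reprK !quotm_scale_pi -raddfD scalerDl.
Qed.

HB.instance Definition _ := GRing.Zmodule_isLmodule.Build S quotm
  quotm_scaleA quotm_scale1 quotm_scaleDr quotm_scaleDl.

Definition quotm_pi (x : V) : quotm := \pi_quotm x.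

Fact quotm_pi_linear : linear quotm_pi.
Proof.
move=> a x y; rewrite /quotm_pi raddfD; congr (_ + _).
by rewrite -[RHS]/(quotm_scale _ _) quotm_scale_pi.
Qed.

End Quotient.

Lemma quotient_exists V (U : V -> Prop) : issub U ->
  exists (Q : lmodType S) (q : {linear V -> Q}),
    surjective q /\ forall x, q x = 0 <-> U x.
Proof.
move=> hU; exists (quotm hU), (mklin (@quotm_pi_linear _ _ hU)).
split=> [y|x]; first by exists (repr y); rewrite mklinE /quotm_pi reprK.
have <- : quotm_pi hU 0 = 0 by rewrite /quotm_pi raddf0.
rewrite mklinE -{2}[x]subr0; split=> [/eqP|Ux].
  by rewrite -Quotient.idealrBE => /asboolP.
by apply/eqP; rewrite -Quotient.idealrBE; apply/asboolP.
Qed.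

End Submodules.

(** * Direct sums and sequential colimits *)

Section DirectSum.
Variables (S : pzRingType) (I : Type) (V : I -> lmodType S).

Definition dprod := forall i, V i.
HB.instance Definition _ := Choice.on dprod.

Definition dprod_zero : dprod := fun=> 0.
Definition dprod_opp (f : dprod) : dprod := fun i => - f i.
Definition dprod_add (f g : dprod) : dprod := fun i => f i + g i.
Definition dprod_scale (a : S) (f : dprod) : dprod := fun i => a *: f i.

Lemma dprod_ext (f g : dprod) : (forall i, f i = g i) -> f = g.
Proof. exact: functional_extensionality_dep. Qed.

Fact dprod_addA : associative dprod_add.
Proof. by move=> f g h; apply: dprod_ext => i; exact: addrA. Qed.

Fact dprod_addC : commutative dprod_add.
Proof. by move=> f g; apply: dprod_ext => i; exact: addrC. Qed.

Fact dprod_add0 : left_id dprod_zero dprod_add.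
Proof. by move=> f; apply: dprod_ext => i; exact: add0r. Qed.

Fact dprod_addN : left_inverse dprod_zero dprod_opp dprod_add.
Proof. by move=> f; apply: dprod_ext => i; exact: addNr. Qed.

HB.instance Definition _ :=
  GRing.isZmodule.Build dprod dprod_addA dprod_addC dprod_add0 dprod_addN.

Fact dprod_scaleA a b f :
  dprod_scale a (dprod_scale b f) = dprod_scale (a * b) f.
Proof. by apply: dprod_ext => i; exact: scalerA. Qed.

Fact dprod_scale1 : left_id 1 dprod_scale.
Proof. by move=> f; apply: dprod_ext => i; exact: scale1r. Qed.

Fact dprod_scaleDr : right_distributive dprod_scale +%R.
Proof. by move=> a f g; apply: dprod_ext => i; exact: scalerDr. Qed.

Fact dprod_scaleDl f : {morph dprod_scale^~ f : a b / a + b}.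
Proof. by move=> a b; apply: dprod_ext => i; exact: scalerDl. Qed.

HB.instance Definition _ := GRing.Zmodule_isLmodule.Build S dprod
  dprod_scaleA dprod_scale1 dprod_scaleDr dprod_scaleDl.

Definition covers (s : seq {classic I}) (f : dprod) :=
  forall i : {classic I}, i \notin s -> f i = 0.

Definition finsupp (f : dprod) := exists s, covers s f.

Fact finsupp_issub : issub finsupp.
Proof.
split; first by exists [::].
move=> a f g [s hs] [t ht]; exists (s ++ t) => i.
rewrite mem_cat negb_or => /andP[si ti].
by rewrite -[LHS]/(a *: f i + g i) hs // ht // scaler0 addr0.
Qed.

Definition dsum : lmodType S := submod (submod_of finsupp_issub).

Definition dpr_fun i (x : dsum) : V i := val x i.
Fact dpr_linear i : linear (dpr_fun i). Proof. by []. Qed.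
Definition dpr i : {linear dsum -> V i} := mklin (dpr_linear i).

Lemma dsum_finsupp (x : dsum) : finsupp (val x).
Proof. exact/(submod_ofP finsupp_issub)/valP. Qed.

Lemma dsum_eq (x y : dsum) : (forall i, dpr i x = dpr i y) -> x = y.
Proof. by move=> h; apply/val_inj/dprod_ext. Qed.

(** [pselect] decides equality in the arbitrary type [I], and the value is transported because the
    summand depends on the index. *)
Definition dinj_val i (x : V i) : dprod := fun j =>
  if pselect (i = j) is left e then eq_rect i V x j e else 0.

Fact dinj_finsupp i (x : V i) : dinj_val x \in submod_of finsupp_issub.
Proof.
apply/(submod_ofP finsupp_issub); exists [:: (i : {classic I})] => j.
rewrite inE => /eqP ij; rewrite /dinj_val; case: pselect => // e.
by case: ij.
Qed.

Definition dinj_fun i (x : V i) : dsum := Submod (dinj_finsupp x).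

Fact dinj_linear i : linear (@dinj_fun i).
Proof.
move=> a x y; apply/val_inj/dprod_ext => j.
rewrite -[RHS]/(a *: dinj_val x j + dinj_val y j) /= /dinj_val.
by case: pselect => [e|_]; [case: _ / e|rewrite scaler0 addr0].
Qed.

Definition dinj i : {linear V i -> dsum} := mklin (@dinj_linear i).

Lemma dpr_same i x : dpr i (dinj i x) = x.
Proof.
rewrite !mklinE /dpr_fun /= /dinj_val; case: pselect => // e.
by rewrite (Prop_irrelevance e erefl).
Qed.

Lemma dpr_diff i j x : i <> j -> dpr j (dinj i x) = 0.
Proof. by move=> ij; rewrite !mklinE /dpr_fun /= /dinj_val; case: pselect. Qed.

Lemma dpr_sum s (F : {classic I} -> dsum) j :
  dpr j (\sum_(i <- s) F i) = \sum_(i <- s) dpr j (F i).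
Proof. exact: linear_sum. Qed.

Lemma dsum_sum (s : seq {classic I}) (x : dsum) :
  uniq s -> covers s (val x) -> x = \sum_(i <- s) dinj i (dpr i x).
Proof.
move=> us sx; apply: dsum_eq => j; rewrite dpr_sum.
have [js|js] := boolP ((j : {classic I}) \in s).
  rewrite (bigD1_seq (j : {classic I})) //= big1 ?addr0 => [|i ij].
    by rewrite -[LHS]dpr_same.
  by apply: dpr_diff => e; move/eqP: ij; apply.
rewrite big1_seq => [|i /andP[_ si]]; first exact: sx.
by apply: dpr_diff => e; move: js; rewrite -e si.
Qed.

(** An element is the finite sum of its injected components. Taking for [U] the submodule where two
    linear maps agree reduces identities to the summands. *)
Lemma dsum_span (x : dsum) (U : dsum -> Prop) :
  issub U -> (forall i, U (dinj i (dpr i x))) -> U x.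
Proof.
move=> hU Ux; have [s sx] := dsum_finsupp x.
rewrite (@dsum_sum (undup s) x) ?undup_uniq //; first exact: issub_sum.
by move=> i; rewrite mem_undup; exact: sx.
Qed.

Section Lift.
Variables (X : lmodType S) (g : forall i, {linear V i -> X}).

Definition dsum_supp (x : dsum) : seq {classic I} :=
  undup (projT1 (cid (dsum_finsupp x))).

Definition dlift_fun (x : dsum) := \sum_(i <- dsum_supp x) g i (dpr i x).

(** Once the indices with zero term are discarded, any two covering lists are permutations of each
    other. *)
Lemma dlift_funE (s : seq {classic I}) x :
  uniq s -> covers s (val x) -> dlift_fun x = \sum_(i <- s) g i (dpr i x).
Proof.
move=> us sx; rewrite /dlift_fun.
have supp t : uniq t -> covers t (val x) -> \sum_(i <- t) g i (dpr i x) =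
    \sum_(i <- [seq i <- t | g i (dpr i x) != 0]) g i (dpr i x).
  move=> ut tx; rewrite big_filter (bigID (fun i => g i (dpr i x) != 0)) /=.
  by rewrite [X in _ + X]big1 ?addr0 // => i /negPn/eqP.
have cov : covers (dsum_supp x) (val x).
  by rewrite /dsum_supp; case: cid => t tx i; rewrite mem_undup; exact: tx.
rewrite supp ?undup_uniq // [RHS]supp //.
apply: (@perm_big _ _ _ {classic I}).
apply: uniq_perm; rewrite ?filter_uniq ?undup_uniq // => i.
rewrite !mem_filter; case: eqP => //= gi.
have nz : val x i <> 0.
  by move=> xi; apply: gi; rewrite -[RHS](linear0 (g i)) -xi.
by apply/idP/idP => _; apply: contra_notT nz; [exact: sx|exact: cov].
Qed.

Fact dlift_linear : linear dlift_fun.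
Proof.
move=> a x y.
pose s := undup (dsum_supp (a *: x + y) ++ dsum_supp x ++ dsum_supp y).
have cov z : {subset dsum_supp z <= s} -> covers s (val z).
  move=> h i si; move: h; rewrite /dsum_supp; case: cid => t tx /= h.
  by apply: tx; apply: contra si => ti; apply: h; rewrite mem_undup.
rewrite !(@dlift_funE s) ?undup_uniq //; try by
  apply: cov => i zi; rewrite mem_undup !mem_cat zi ?orbT.
rewrite scaler_sumr -big_split; apply: eq_bigr => i _.
by rewrite /= !linearP.
Qed.

Definition dlift : {linear dsum -> X} := mklin dlift_linear.

Lemma dliftE i x : dlift (dinj i x) = g i x.
Proof.
rewrite mklinE (@dlift_funE [:: i]) //; first by rewrite big_seq1 dpr_same.
move=> j; rewrite inE => /eqP ij; apply: dpr_diff => e; exact: ij.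
Qed.

End Lift.
End DirectSum.

Global Opaque dpr dinj dlift.

(** * Colimits of sequences of injections *)

Section Colimit.
Variables (S : pzRingType) (F : nat -> lmodType S).
Variable phi : forall k, {linear F k -> F k.+1}.
Hypothesis phi_inj : forall k, injective (phi k).

(* The colimit is [dsum F] modulo the families killed by [push N] for all large
   [N]. *)
Fixpoint push N : {linear dsum F -> F N} :=
  if N is N'.+1 then
    GRing.add_fun (phi N' \o push N') (dpr F N'.+1)
  else dpr F 0.

(** An element injected at index [k] is unchanged by [push k] and is then moved by the maps [phi].
    Their injectivity makes each [u k] injective; raising two elements to a common stage shows that
    the images exhaust the quotient. *)
Lemma colim_exists : exists (X : lmodType S) (u : forall k, {linear F k -> X}),
  [/\ forall k x, u k.+1 (phi k x) = u k x,
      forall k, injective (u k) & forall x, exists k y, u k y = x].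
Proof.
pose U (x : dsum F) := exists N, forall N', (N <= N')%N -> push N' x = 0.
have hU : issub U.
  split; first by exists 0%N => N _; rewrite linear0.
  move=> a x y [N hN] [N' hN']; exists (maxn N N') => k.
  rewrite geq_max => /andP[Nk N'k].
  by rewrite linearP hN // hN' // scaler0 addr0.
have [X [q [sq qU]]] := quotient_exists hU.
have push_lt k x N : (N < k)%N -> push N (dinj F k x) = 0.
  elim: N => [|N IH] Nk /=; first by apply: dpr_diff; case: k x Nk.
  rewrite IH ?(ltn_trans _ Nk) // linear0 dpr_diff ?addr0 // => e.
  by rewrite e ltnn in Nk.
have push_eq k x : push k (dinj F k x) = x.
  case: k x => [|k] x /=; first exact: dpr_same.
  by rewrite push_lt // linear0 add0r; exact: dpr_same.
have push_gt k x N : (k <= N)%N ->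
    push N.+1 (dinj F k x) = phi N (push N (dinj F k x)).
  move=> kN /=; rewrite dpr_diff ?addr0 // => e.
  by rewrite e ltnn in kN.
have uphi k x : q (dinj F k.+1 (phi k x)) = q (dinj F k x).
  apply/eqP; rewrite -subr_eq0 -linearB; apply/eqP/qU; exists k.+1 => N kN.
  rewrite linearB /= -(subnK kN); elim: (N - _)%N => [|d IH].
    by rewrite push_eq push_gt // push_eq subrr.
  have := IH; rewrite addSn.
  rewrite !push_gt ?leq_addl //; last first.
    by rewrite (leq_trans (leqnSn k)) ?leq_addl.
  by move/eqP; rewrite subr_eq0 => /eqP->; rewrite subrr.
exists X, (fun k => q \o dinj F k); split=> [k x|k|x].
- exact: uphi.
- apply: linear_inj => x /qU[N hN].
  have {hN} : push (maxn k N) (dinj F k x) = 0 by apply: hN; exact: leq_maxr.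
  rewrite -(subnK (leq_maxl k N)); elim: (_ - _)%N => [|d IH].
    by rewrite push_eq.
  rewrite addSn push_gt ?leq_addl // -[RHS](linear0 (phi (d + k)%N)).
  by move/phi_inj.
have [y <-] := sq x; apply: (@dsum_span _ _ _ y (fun y =>
  exists k z, q (dinj F k z) = q y)); last by move=> i; exists i, (dpr F i y).
have up k x' : forall d, exists z, q (dinj F (d + k)%N z) = q (dinj F k x').
  elim=> [|d [z <-]]; first by exists x'.
  by exists (phi (d + k)%N z); exact: uphi.
split; first by exists 0%N, 0; rewrite !linear0.
move=> a x1 x2 [k1 [z1 e1]] [k2 [z2 e2]].
have [y1 h1] := up k1 z1 k2; have [y2 h2] := up k2 z2 k1.
move: y2 h2; rewrite addnC => y2 h2.
by exists (k2 + k1)%N, (a *: y1 + y2); rewrite !linearP h1 h2 e1 e2.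
Qed.

End Colimit.

(** * Lifting and extension properties *)

Section Extensions.
Variable S : pzRingType.
Implicit Types V W X T J E P : lmodType S.

Definition submod_incl V (U : submodClosed V) : {linear submod U -> V} := \val.

Lemma submod_incl_inj V (U : submodClosed V) : injective (submod_incl U).
Proof. exact: val_inj. Qed.

Definition pair_lin V W X (f : {linear V -> W}) (g : {linear V -> X}) (x : V) :
  (W * X)%type := (f x, g x).

Fact pair_lin_linear V W X (f : {linear V -> W}) (g : {linear V -> X}) :
  linear (pair_lin f g).
Proof. by move=> a x y; congr pair; exact: linearP. Qed.
HB.instance Definition _ V W X (f : {linear V -> W}) (g : {linear V -> X}) :=
  GRing.isLinear.Build S V (W * X)%type *:%R (pair_lin f g)
    (pair_lin_linear f g).

Definition lin_fst V W : {linear (V * W)%type -> V} := fst.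
Definition lin_snd V W : {linear (V * W)%type -> W} := snd.
Definition lin_id V : {linear V -> V} := idfun.
Definition lin_zero V W : {linear V -> W} := \0.

(** Finite generation for predicates; as the range of a linear map, such a [U] is automatically a
    submodule. *)
Definition fgs V (U : V -> Prop) :=
  exists m (G : {linear 'rV[S]_m -> V}), forall x, U x <-> exists d, G d = x.

Lemma fgs_kernel V W (f : {linear V -> W}) :
  fgs (fun x => f x = 0) <-> finitely_generated (submod (kernel f)).
Proof.
split=> [[m [G hG]]|[m [g sg]]].
  have [|g hg] := @factor_inj _ _ _ _ (submod_incl (kernel f)) G
    (@submod_incl_inj _ _).
    move=> d; have fGd : G d \in (kernel f : submodClosed V).
      by rewrite inE; apply/eqP/hG; exists d.
    by exists (Submod fGd).
  exists m, g => y; have /hG[d Gd] : f (val y) = 0 by apply/eqP/(valP y).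
  by exists d; apply: val_inj; rewrite -Gd -hg.
exists m, (submod_incl (kernel f) \o g) => x; split=> [fx|[d <-]].
  have kx : x \in (kernel f : submodClosed V) by rewrite inE; apply/eqP.
  by have [d gd] := sg (Submod kx); exists d; rewrite /= gd.
exact/eqP/(valP (g d)).
Qed.

(** The pullback of the extension along [f] is an extension of [T] by [J]. Its splitting, followed
    by the projection to [E], is the lift. *)
Lemma ext_lift T J E X (j : {linear J -> E}) (p : {linear E -> X})
    (f : {linear T -> X}) :
  Ext1_eq0 T J -> short_exact j p ->
  exists g : {linear T -> E}, forall t, p (g t) = f t.
Proof.
move=> extTJ [inj_j ex_p sur_p].
pose d : {linear (E * T)%type -> X} :=
  GRing.sub_fun (p \o @lin_fst E T) (f \o @lin_snd E T).
pose P := submod (kernel d).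
have memP e t : ((e, t) \in (kernel d : submodClosed _)) = (p e == f t).
  by rewrite inE /= subr_eq0.
have [|i hi] := @factor_inj _ _ _ _ (submod_incl (kernel d))
   (@pair_in S T E \o j) (@submod_incl_inj _ _).
  move=> x; have h : (j x, 0) \in (kernel d : submodClosed (E * T)%type).
    by rewrite memP linear0; apply/eqP/ex_p; exists x.
  by exists (Submod h).
have exP : short_exact i (@lin_snd E T \o submod_incl (kernel d)).
  split=> [x y ixy|y|t].
  - have := hi x; rewrite ixy hi => -[/inj_j <-] //.
  - split=> [/= y2|[x <-]]; last exact: (congr1 snd (hi x)).
    have : val y \in (kernel d : submodClosed _) by exact: valP.
    case ey: (val y) => [e t]; rewrite memP.
    rewrite ey /= in y2; rewrite y2 linear0 => /eqP/ex_p[x jx].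
    by exists x; apply: val_inj; rewrite [LHS]hi ey y2 -jx.
  - have [e pe] := sur_p (f t).
    have h : (e, t) \in (kernel d : submodClosed _) by rewrite memP pe.
    by exists (Submod h).
have [h [hin hout]] := extTJ (Extension exP).
(* The parts of the five lemma needed to invert [h] on the summand [T]. *)
have inj_h : injective h.
  apply: linear_inj => y hy.
  have := hout y; rewrite hy linear0 => /esym y2.
  have [_ /(_ y)/iffLR/(_ y2)[x ix] _] := exP.
  by have := hin x; rewrite /= ix hy -ix => -[<-]; rewrite linear0.
have sur_h t : exists y, h y = (0, t).
  have [_ _ /(_ t)[y yt]] := exP.
  have := hout y; rewrite /= -[RHS]/((lin_snd E T \o submod_incl _) y) yt.
  case ehy: (h y) => [x t'] /= tt'.
  exists (y - i x); rewrite linearB ehy.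
  by rewrite [X in _ - X]hin tt'; congr pair; rewrite /= ?subrr ?subr0.
pose in2 : {linear T -> (J * T)%type} := pair_lin (@lin_zero T J) (@lin_id T).
have [|s hs] := @factor_inj _ _ _ _ h in2 inj_h; first exact: sur_h.
exists (@lin_fst E T \o submod_incl (kernel d) \o s) => t.
have e2 := hout (s t); rewrite hs /= in e2.
have := valP (s t); rewrite [val (s t)]surjective_pairing memP => /eqP pe.
by rewrite {2}e2 -pe.
Qed.

(** A section [s] yields the retraction [e - s (p e)] onto the image of [j], which with [p] gives
    the equivalence. *)
Lemma ext_split T J :
  (forall E (j : {linear J -> E}) (p : {linear E -> T}), short_exact j p ->
    exists s : {linear T -> E}, forall t, p (s t) = t) -> Ext1_eq0 T J.
Proof.
move=> h [E j p ex]; have [s ps] := h E j p ex; have [inj_j ex_p _] := ex.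
pose d : {linear E -> E} := GRing.sub_fun (@lin_id E) (s \o p).
have [|r hr] := @factor_inj _ _ _ _ j d inj_j.
  by move=> e; apply/ex_p; rewrite /= linearB /= ps subrr.
exists (pair_lin r p); split=> [x|//] /=.
have pj : p (j x) = 0 by apply/ex_p; exists x.
rewrite /pair_lin pj; congr pair; apply: inj_j.
by rewrite hr /= pj linear0 subr0.
Qed.

(** Dual to [ext_lift]: push out along [h], as the quotient of [J * P] by the pairs [(h x, - d x)].
    The map [d] need not be injective; the inclusion of kernels makes [J] embed in the pushout.
    Subtracting the section from the image of [P] lands in [J]. *)
Lemma ext_extend T J P X (d : {linear X -> P}) (q : {linear P -> T})
    (h : {linear X -> J}) :
  Ext1_eq0 T J -> surjective q -> (forall y, q y = 0 <-> exists x, d x = y) ->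
  (forall x, d x = 0 -> h x = 0) ->
  exists k : {linear P -> J}, forall x, k (d x) = h x.
Proof.
move=> extTJ sur_q ker_q dh.
pose c : {linear X -> (J * P)%type} := pair_lin h (GRing.opp_fun d).
have [E [pi [sur_pi ker_pi]]] := quotient_exists (issub_range c).
have [|p hp] := @factor_surj _ _ _ _ pi (q \o @lin_snd J P) sur_pi.
  move=> y /ker_pi[x <-] /=; rewrite linearN; apply/eqP.
  by rewrite oppr_eq0; apply/eqP/ker_q; exists x.
have pi_d x : pi (0, d x) = pi (h x, 0).
  apply/eqP; rewrite eq_sym -subr_eq0 -linearB; apply/eqP/ker_pi; exists x.
  by congr pair; rewrite /= ?subr0 ?sub0r.
pose j : {linear J -> E} := pi \o @pair_in S P J.
have ex : short_exact j p.
  split=> [|e|t].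
  - apply: linear_inj => x /ker_pi[y [<- /eqP]].
    by rewrite oppr_eq0 => /eqP/dh.
  - have [[a y] <-] := sur_pi e; rewrite hp /=.
    split=> [/ker_q[x <-]|[b /eqP]].
      exists (a + h x); rewrite /= /pair_in.
      have -> : (a, d x) = (a, 0) + (0, d x) :> J * P.
        by congr pair; rewrite /= ?addr0 ?add0r.
      rewrite linearD pi_d -linearD; congr (pi _).
      by congr pair; rewrite /= addr0.
    rewrite -subr_eq0 -linearB => /eqP/ker_pi[x [_ /eqP]].
    rewrite /= sub0r eqr_opp => /eqP <-.
    by apply/ker_q; exists x.
  - have [y <-] := sur_q t; exists (pi (0, y)); exact: hp.
have [s hs] := ext_lift (@lin_id T) extTJ ex; have [inj_j ker_p _] := ex.
pose in2 : {linear P -> (J * P)%type} := pair_lin (@lin_zero P J) (@lin_id P).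
have [|k hk] := @factor_inj _ _ _ _ j
  (GRing.sub_fun (pi \o in2) (s \o q)) inj_j.
  by move=> y; apply/ker_p; rewrite /= linearB hp hs subrr.
exists k => x; apply: inj_j; rewrite hk /=.
have -> : q (d x) = 0 by apply/ker_q; exists x.
by rewrite linear0 subr0; exact: pi_d.
Qed.

(** The cokernel of [G] is finitely presented, so [ext_extend] applies. *)
Lemma fp_injective_extend J m n (G : {linear 'rV[S]_m -> 'rV[S]_n})
    (h : {linear 'rV[S]_m -> J}) :
  fp_injective J -> (forall d, G d = 0 -> h d = 0) ->
  exists k : {linear 'rV[S]_n -> J}, forall d, k (G d) = h d.
Proof.
move=> fpJ Gh; have [T [q [sur_q ker_q]]] := quotient_exists (issub_range G).
apply: (ext_extend _ sur_q ker_q Gh); apply: fpJ.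
by exists n, q; split=> //; apply/fgs_kernel; exists m, G.
Qed.

(** Lift a presentation [f] of [T] to [E]. On the relations the lift takes values in [J]; correcting
    it by an extension of this restriction makes it vanish there, so it descends to a section. *)
Lemma fp_injective_crit J :
  (forall m n (G : {linear 'rV[S]_m -> 'rV[S]_n}) (h : {linear 'rV[S]_m -> J}),
    (forall d, G d = 0 -> h d = 0) ->
    exists k : {linear 'rV[S]_n -> J}, forall d, k (G d) = h d) ->
  fp_injective J.
Proof.
move=> ext T [n [f [sur_f /fgs_kernel[m [G hG]]]]]; apply: ext_split => E j p.
move=> [inj_j ker_p sur_p].
have [g hg] := free_lift f sur_p.
have [|h hh] := @factor_inj _ _ _ _ j (g \o G) inj_j.
  by move=> d; apply/ker_p; rewrite /= hg; apply/hG; exists d.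
have [|k hk] := ext _ _ G h.
  by move=> d Gd; apply: inj_j; rewrite hh /= Gd !linear0.
have [|s hs] := @factor_surj _ _ _ _ f (GRing.sub_fun g (j \o k)) sur_f.
  by move=> x /hG[d <-]; rewrite /= hk hh subrr.
exists s => t; have [x <-] := sur_f t; rewrite hs /= linearB hg.
have -> : p (j (k x)) = 0 by apply/ker_p; exists (k x).
by rewrite subr0.
Qed.

Lemma fp_projectiveP P : fp_projective P <->
  forall J E X (j : {linear J -> E}) (p : {linear E -> X}), fp_injective J ->
    short_exact j p -> forall f : {linear P -> X},
    exists g : {linear P -> E}, forall x, p (g x) = f x.
Proof.
split=> [fpP J E X j p fpJ ex f|lift J fpJ].
  exact: ext_lift (fpP J fpJ) ex.
by apply: ext_split => E j p ex; exact: (lift J E P j p fpJ ex (@lin_id P)).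
Qed.

Lemma fp_projective_retract P X (s : {linear X -> P}) (r : {linear P -> X}) :
  (forall x, r (s x) = x) -> fp_projective P -> fp_projective X.
Proof.
move=> rs /fp_projectiveP fpP; apply/fp_projectiveP => J E Y j p fpJ ex f.
have [g hg] := fpP J E Y j p fpJ ex (f \o r).
by exists (g \o s) => x; rewrite /= hg /= rs.
Qed.

Lemma fp_projective_dsum (I : Type) (V : I -> lmodType S) :
  (forall i, fp_projective (V i)) -> fp_projective (dsum V).
Proof.
move=> fpV; apply/fp_projectiveP => J E Y j p fpJ ex f.
pose g i :=
  cid ((fp_projectiveP (V i)).1 (fpV i) J E Y j p fpJ ex (f \o dinj V i)).
exists (dlift (fun i => projT1 (g i))) => x.
apply: (@dsum_span _ _ _ x (fun x => p (dlift _ x) = f x)).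
  split=> [|a y z hy hz]; first by rewrite !linear0.
  by rewrite !linearP hy hz.
by move=> i; rewrite dliftE (projT2 (g i)).
Qed.

Lemma fp_projective_regular : fp_projective S^o.
Proof.
apply/fp_projectiveP => J E Y j p _ [_ _ sur_p] f.
have [e pe] := sur_p (f 1).
have lg : linear (fun a : S^o => a *: e).
  by move=> a x y; rewrite scalerDl scalerA.
exists (mklin lg) => a; rewrite mklinE linearZ /= pe -linearZ /=.
by rewrite /GRing.scale /= mulr1.
Qed.

Lemma finitely_presented_fp_projective T :
  finitely_presented T -> fp_projective T.
Proof. by move=> fpT J; exact. Qed.

End Extensions.

(** * The Hill lemma *)

Section Span.
Variables (S : pzRingType) (I : eqType) (F : lmodType S) (sz : I -> nat).
Variable b : forall i, {linear 'rV[S]_(sz i) -> F}.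
Implicit Types (P Q A : I -> Prop) (x : F).

Definition gen P x :=
  forall U : F -> Prop, issub U -> (forall i c, P i -> U (b i c)) -> U x.

Lemma gen_issub P : issub (gen P).
Proof.
split=> [U hU _|a x y hx hy U hU Ub]; first exact: issub0.
by apply: hU.2; [exact: hx|exact: hy].
Qed.

Lemma gen_b P i c : P i -> gen P (b i c).
Proof. by move=> Pi U _; apply. Qed.

Lemma gen_ind P (U : F -> Prop) : issub U ->
  (forall i c, P i -> U (b i c)) -> forall x, gen P x -> U x.
Proof. by move=> hU Ub x; apply. Qed.

Lemma gen_mono P Q x : (forall i, P i -> Q i) -> gen P x -> gen Q x.
Proof.
move=> PQ; move: x; apply: gen_ind => [|i c /PQ Qi]; first exact: gen_issub.
exact: gen_b.
Qed.

Lemma gen_cup P Q x : gen (fun i => P i \/ Q i) x ->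
  exists2 w, gen Q w & gen P (x - w).
Proof.
move: x; apply: gen_ind; first by apply: issub_add; exact: gen_issub.
move=> i c [Pi|Qi].
  by exists 0; [exact: issub0 (gen_issub _)|rewrite subr0; exact: gen_b].
exists (b i c); first exact: gen_b.
by rewrite subrr; exact: issub0 (gen_issub _).
Qed.

Lemma gen_cup_seq P Q (T : seq I) n (Z : {linear 'rV[S]_n -> F}) x :
  (forall i, Q i <-> P i \/ i \in T) ->
  (forall y, gen (fun i => i \in T) y <-> exists c, Z c = y) ->
  gen Q x -> exists c, gen P (x - Z c).
Proof.
move=> QE hZ /(gen_mono (fun i => (QE i).1))/gen_cup[_ /hZ[c <-] Px].
by exists c.
Qed.

Lemma gen_split i P x : gen P x ->
  exists c, gen (fun j => P j /\ j <> i) (x - b i c).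
Proof.
move=> Px; suff [_ [c <-] ?] :
    exists2 w, exists c, b i c = w & gen (fun j => P j /\ j <> i) (x - w).
  by exists c.
move: x Px; apply: gen_ind.
  by apply: issub_add; [exact: gen_issub|exact: issub_range].
move=> j c Pj; case: (eqVneq j i) => [e|/eqP ji].
  exists (b j c); first by rewrite e in c *; exists c.
  by rewrite subrr; exact: issub0 (gen_issub _).
exists 0; first by exists 0; rewrite linear0.
by rewrite subr0; exact: gen_b.
Qed.

Lemma gen_dir (K : Type) (P : K -> I -> Prop) x : K ->
  (forall k l, exists m,
    (forall i, P k i -> P m i) /\ forall i, P l i -> P m i) ->
  gen (fun i => exists k, P k i) x -> exists k, gen (P k) x.
Proof.
move=> k0 dir; move: x; apply: gen_ind => [|i c [k Pi]]; last first.
  by exists k; exact: gen_b.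
split=> [|a y z [k hk] [l hl]]; first by exists k0; exact: issub0 (gen_issub _).
have [m [km lm]] := dir k l; exists m.
by apply: (gen_issub _).2; [exact: gen_mono hk|exact: gen_mono hl].
Qed.

Lemma gen_fin P x : gen P x ->
  exists2 T : seq I, forall i, i \in T -> P i & gen (fun i => i \in T) x.
Proof.
move: x; apply: gen_ind => [|i c Pi]; last first.
  exists [:: i]; first by move=> j; rewrite inE => /eqP->.
  by apply: gen_b; rewrite inE.
split=> [|a y z [T PT hy] [T' PT' hz]].
  by exists [::] => //; exact: issub0 (gen_issub _).
exists (T ++ T').
  by move=> i; rewrite mem_cat => /orP[]; [exact: PT|exact: PT'].
by apply: (gen_issub _).2; [apply: gen_mono hy|apply: gen_mono hz] => i iT;
  rewrite mem_cat iT ?orbT.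
Qed.

Lemma gen_fin_lin P n (Z : {linear 'rV[S]_n -> F}) :
  (forall c, gen P (Z c)) ->
  exists2 T : seq I, forall i, i \in T -> P i &
    forall c, gen (fun i => i \in T) (Z c).
Proof.
move=> PZ; have [T hT] := choice (fun k : 'I_n =>
  let: ex_intro2 T h1 h2 := gen_fin (PZ (delta_mx 0 k)) in
  ex_intro (fun T : seq I => (forall i, i \in T -> P i) /\
    gen (fun i => i \in T) (Z (delta_mx 0 k))) T (conj h1 h2)).
exists (flatten [seq T k | k <- enum 'I_n]).
  by move=> i /flatten_mapP[k _]; exact: (hT k).1.
move=> c; set T' := flatten _.
have hU := issub_preim Z (gen_issub (fun i => i \in T')).
rewrite [c]row_sum_delta; apply: (issub_sum hU) => k _; apply: (issubZ hU).
apply: gen_mono (hT k).2 => i iT; apply/flatten_mapP; exists k => //.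
exact: mem_enum.
Qed.

Lemma gen_basis (T : seq I) : exists q (Z : {linear 'rV[S]_q -> F}),
  forall x, gen (fun i => i \in T) x <-> exists c, Z c = x.
Proof.
elim: T => [|i T [q [Z hZ]]].
  exists 0%N, (@lin_zero _ _ _) => x; split=> [|[c <-]].
    by move: x; apply: gen_ind => [|//]; exact: issub_range.
  exact: issub0 (gen_issub _).
pose Z' : {linear 'rV[S]_(sz i + q) -> F} :=
  GRing.add_fun (b i \o lsubmx) (Z \o rsubmx).
exists (sz i + q)%N, Z' => x; split=> [|[c <-]].
  move: x; apply: gen_ind => [|j c]; first exact: issub_range.
  rewrite inE; case: (eqVneq j i) => [e _|_ /= jT].
    rewrite e in c *; exists (row_mx c 0).
    by rewrite /= row_mxKl row_mxKr linear0 addr0.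
  have [d hd] := (hZ (b j c)).1 (@gen_b (fun i => i \in T) j c jT).
  by exists (row_mx 0 d); rewrite /= row_mxKl row_mxKr linear0 add0r.
rewrite -[Z' c]/(b i (lsubmx c) + Z (rsubmx c)); apply: (issubD (gen_issub _)).
  by apply: gen_b; rewrite mem_head.
apply: (@gen_mono (fun i => i \in T)).
  by move=> j jT; rewrite inE jT orbT.
by apply/hZ; exists (rsubmx c).
Qed.

(** * Cells with ranks, and closed sets of cells *)

Section Ranked.
Variable rk : I -> nat.

Definition lower i j := (rk j < rk i)%N.

(* The attaching maps of the cells in [A] only involve cells in [A]. *)
Definition hill_closed A := forall i, A i -> (0 < rk i)%N -> forall c,
  gen (fun j => lower i j) (b i c) -> gen (fun j => A j /\ lower i j) (b i c).

Lemma hill_closed_cup (K : Type) (P : K -> I -> Prop) :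
  (forall k, hill_closed (P k)) -> hill_closed (fun i => exists k, P k i).
Proof.
move=> clP i [k Pi] ri c low; apply: gen_mono (clP k i Pi ri c low) => j [Pj ?].
by split=> //; exists k.
Qed.

(** An attaching map has a finitely generated domain, and, as in a pushout, a cell meets the span of
    the other cells of at most its rank only in that domain. *)
Hypothesis gen_lower_fgs : forall i, (0 < rk i)%N ->
  fgs (fun c => gen (fun j => lower i j) (b i c)).
Hypothesis gen_lower : forall i c, (0 < rk i)%N ->
  gen (fun j => j <> i /\ (rk j <= rk i)%N) (b i c) ->
  gen (fun j => lower i j) (b i c).

(** Starting from finitely many cells of [A], the cells of highest rank are removed one at a time
    ([drop]), and the ranks are lowered down to [m] ([down]). *)
Lemma gen_cap A m x : hill_closed A -> gen A x ->
  gen (fun i => (rk i <= m)%N) x -> gen (fun i => A i /\ (rk i <= m)%N) x.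
Proof.
move=> clA.
have drop N (T : seq I) y : (forall i, i \in T -> A i /\ rk i = N.+1) ->
    gen (fun i => i \in T \/ A i /\ (rk i <= N)%N) y ->
    gen (fun i => (rk i <= N)%N) y -> gen (fun i => A i /\ (rk i <= N)%N) y.
  elim: T y => [|t T IH] y AT hy yN; first by apply: gen_mono hy => i [].
  have [At rt] := AT t (mem_head _ _); have [c hc] := gen_split t hy.
  (* The contribution of [t] is [y] minus the rest, so it lies in the span of other cells of rank at
     most [N.+1]. By [gen_lower] it lies in the span of lower cells, and closedness of [A] allows
     cells of [A] only. *)
  have bt : gen (fun j => A j /\ (rk j <= N)%N) (b t c).
    apply: (@gen_mono (fun j => A j /\ lower t j)).
      by move=> j; rewrite /lower rt ltnS.
    apply: clA => //; rewrite ?rt //; apply: gen_lower; rewrite ?rt //.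
    rewrite -[b t c](subKr y); apply: (issubB (gen_issub _)).
      apply: gen_mono yN => j jN; split; last exact: leqW.
      by move=> e; rewrite e rt ltnn in jN.
    apply: gen_mono hc => j [[jT|[_ jN]] jt]; split=> //; last exact: leqW.
    by rewrite (AT j jT).2.
  rewrite -[y](subrK (b t c)); apply: (issubD (gen_issub _)); last exact: bt.
  apply: IH => [j jT||]; first by apply: AT; rewrite inE jT orbT.
    apply: gen_mono hc => j [[|]]; last by right.
    by rewrite inE => /orP[/eqP|]; [|left].
  apply: (issubB (gen_issub _)) => //.
  by apply: gen_mono bt => j [].
have down N y : gen (fun i => A i /\ (rk i <= N)%N) y ->
    gen (fun i => (rk i <= m)%N) y -> gen (fun i => A i /\ (rk i <= m)%N) y.
  elim: N y => [|N IH] y hy ym.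
    by apply: gen_mono hy => i [Ai ri]; split=> //; exact: leq_trans ri _.
  have [mN|Nm] := leqP m N; last first.
    by apply: gen_mono hy => i [Ai ri]; split=> //; exact: leq_trans ri _.
  apply: IH => //; have [T AT hT] := gen_fin hy.
  apply: (drop _ [seq i <- T | rk i == N.+1]).
  - by move=> i; rewrite mem_filter => /andP[/eqP ri /AT[]].
  - apply: gen_mono hT => i iT; rewrite mem_filter iT andbT.
    have [Ai] := AT i iT; rewrite leq_eqVlt => /orP[->|ri]; first by left.
    by right.
  - by apply: gen_mono ym => i im; exact: leq_trans im mN.
move=> /gen_fin[T AT hx]; apply: (down (\max_(i <- T) rk i)).
by apply: gen_mono hx => i iT; split; [exact: AT|exact: leq_bigmax_seq].
Qed.

Section Reach.
(** [Q] is what is propagated while cells are adjoined one by one: later inclusion, [coh], or the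
    trivial relation. *)
Variable Q : (I -> Prop) -> (I -> Prop) -> Prop.
Hypothesis Q_refl : forall A, Q A A.
Hypothesis Q_trans : forall A B C, Q A B -> Q B C -> Q A C.
Hypothesis Q_step : forall A i,
  hill_closed A -> hill_closed (fun j => A j \/ j = i) ->
  ~ A i -> Q A (fun j => A j \/ j = i).

Definition reachable A (l : seq I) := exists B : I -> Prop,
  [/\ hill_closed B, Q A B, (exists T : seq I, forall j, B j <-> A j \/ j \in T)
    & forall j, j \in l -> B j].

(** Induction on rank: first adjoin the finitely many lower cells that the attaching map of [i]
    involves, then [i] itself. *)
Lemma reach (l : seq I) A : hill_closed A -> reachable A l.
Proof.
have reach_seq (l' : seq I) : (forall i, i \in l' -> forall B, hill_closed B ->
    reachable B [:: i]) -> forall B, hill_closed B -> reachable B l'.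
  elim: l' => [|i l' IH] hl B clB.
    by exists B; split=> //; exists [::] => j; split=> [|[]//]; left.
  have [B1 [clB1 QB1 [T1 hT1] iB1]] := hl i (mem_head _ _) B clB.
  have [|B2 [clB2 QB2 [T2 hT2] lB2]] := IH _ B1 clB1.
    by move=> j jl; apply: hl; rewrite inE jl orbT.
  exists B2; split=> //; first exact: Q_trans QB1 QB2.
    exists (T1 ++ T2) => j; rewrite hT2 hT1 mem_cat.
    by split=> [[[]|]|[|/orP[]]]; intuition; right; apply/orP; intuition.
  move=> j; rewrite inE => /orP[/eqP ->|/lB2 //].
  by apply/hT2; left; apply: iB1; rewrite inE.
apply: (reach_seq) => i _ {A l}.
have [n] := ubnP (rk i); elim: n i => // n IH i; rewrite ltnS => rn A clA.
have [Ai|nAi] := EM (A i).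
  exists A; split=> //; first by exists [::] => j; split=> [|[]//]; left.
  by move=> j; rewrite inE => /eqP->.
(* Finite generation of the attaching domain makes finitely many lower cells suffice; rank [0]
   requires none. *)
have [T lowT hT] : exists2 T : seq I, forall j, j \in T -> lower i j &
    (0 < rk i)%N -> forall c, gen (fun j => lower i j) (b i c) ->
    gen (fun j => j \in T) (b i c).
  have [ri|ri] := leqP (rk i) 0; first by exists [::].
  have [m [G hG]] := gen_lower_fgs ri.
  have [|T lowT hT] := @gen_fin_lin (lower i) _ (b i \o G).
    by move=> d; apply/hG; exists d.
  by exists T => // _ c /hG[d <-]; exact: hT.
have [|B [clB QB [T' hT'] TB]] := reach_seq T _ A clA.
  by move=> j /lowT jT; apply: IH; exact: leq_trans jT rn.
have [Bi|nBi] := EM (B i).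
  exists B; split=> //; first by exists T'.
  by move=> j; rewrite inE => /eqP->.
have clB' : hill_closed (fun j => B j \/ j = i).
  move=> j [Bj|->] rj c low.
    by apply: gen_mono (clB j Bj rj c low) => k [? ?]; split=> //; left.
  apply: gen_mono (hT rj c low) => k kT.
  by split; [left; exact: TB|exact: lowT].
exists (fun j => B j \/ j = i); split=> //.
- exact: Q_trans QB (Q_step clB clB' nBi).
- exists (i :: T') => j; rewrite hT' inE.
  by split=> [[[]|->]|[|/orP[/eqP|]]]; rewrite ?eqxx; intuition;
    right; apply/orP; intuition.
- by move=> j; rewrite inE => /eqP->; right.
Qed.

End Reach.

(** * Coherence of quotients of spans of closed sets *)

Section Coherent.
Hypothesis coherent : forall n k (u : {linear 'rV[S]_n -> 'rV[S]_k}) L,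
  fgs L -> fgs (fun c => L (u c)).
Hypothesis rk0 : forall i c, rk i = 0%N -> b i c = 0.

(* [gen B / gen A] is a coherent module, stated without forming the quotient. *)
Definition coh A B := (forall i, A i -> B i) /\
  forall n (G : {linear 'rV[S]_n -> F}), (forall c, gen B (G c)) ->
    fgs (fun c => gen A (G c)).

(** The intersection is computed on the free module parametrising [L], where the pullback of [L'] is
    known to be finitely generated. *)
Lemma fgs_comp n m (H : {linear 'rV[S]_m -> 'rV[S]_n})
    (L L' : 'rV[S]_n -> Prop) :
  (forall c, L c <-> exists d, H d = c) -> fgs (fun d => L' (H d)) ->
  fgs (fun c => L c /\ L' c).
Proof.
move=> hH [k [K hK]]; exists k, (H \o K) => c; split.
  by move=> [/hH[d <-]] /hK[e <-]; exists e.
by move=> [e <-]; split; [apply/hH; exists (K e)|apply/hK; exists e].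
Qed.

Lemma fgs_ext (V : lmodType S) (L L' : V -> Prop) :
  (forall c, L c <-> L' c) -> fgs L -> fgs L'.
Proof. by move=> LL' [m [G hG]]; exists m, G => x; rewrite -LL'. Qed.

Lemma fgs_true n : fgs (fun _ : 'rV[S]_n => True).
Proof. by exists n, (@lin_id S _) => c; split=> // _; exists c. Qed.

Lemma coh_refl A : coh A A.
Proof.
split=> // n G hG; apply: fgs_ext (fgs_true n) => c.
by split=> // _; exact: hG.
Qed.

Lemma coh_trans A B C : coh A B -> coh B C -> coh A C.
Proof.
move=> [AB cAB] [BC cBC]; split=> [i /AB /BC //|n G hG].
have [m [H hH]] := cBC n G hG.
have GH d : gen B ((G \o H) d) by apply/hH; exists d.
have := @fgs_comp _ _ H _ (fun c => gen A (G c)) hH (cAB _ (G \o H) GH).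
apply: fgs_ext => c.
by split=> [[]//|hc]; split=> //; exact: gen_mono hc.
Qed.

(** The quotient is ['rV_(sz i)] modulo the [v] with [b i v] in [gen A]. These form the attaching
    domain of [i], which is finitely generated; [coherent] then pulls it back along a lift [u] of
    [G]. *)
Lemma coh_step A i :
  hill_closed A -> hill_closed (fun j => A j \/ j = i) -> ~ A i ->
  coh A (fun j => A j \/ j = i).
Proof.
move=> clA clA' nAi; split=> [j|n G hG]; first by left.
have [||u hu] := @free_sel _ n _ (fun c v => gen A (G c - b i v)).
- exact: (rel_linear_eq _ _ (gen_issub A)).
- move=> c; have [v hv] := gen_split i (hG c); exists v.
  by apply: gen_mono hv => j [[]].
have Gu c : gen A (G c) <-> gen A (b i (u c)).
  split=> h; [rewrite -[b i _](subKr (G c))|rewrite -[G c](subrK (b i (u c)))].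
    by apply: (issubB (gen_issub _)) => //; exact: hu.
  by apply: (issubD (gen_issub _)) => //; exact: hu.
suff : fgs (fun v => gen A (b i v)).
  by move=> /(coherent u); apply: fgs_ext => c; rewrite Gu.
have [ri|ri] := leqP (rk i) 0.
  apply: fgs_ext (fgs_true _) => v; split=> // _.
  by rewrite rk0; [exact: issub0 (gen_issub _)|apply/eqP; rewrite -leqn0].
apply: fgs_ext (gen_lower_fgs ri) => v; split=> h.
  apply: gen_mono (clA' i _ ri v h) => [j [[//|->]]|]; last by right.
  by rewrite /lower ltnn.
apply: gen_lower => //.
(* Restricting to rank at most [rk i] leaves cells of [A], hence cells other than [i], as
   [gen_lower] requires. *)
have := @gen_cap A (rk i) _ clA h (gen_b v (leqnn _)).
by apply: gen_mono => j [Aj ?]; split=> // e; rewrite e in Aj.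
Qed.

(** The range of [G] involves finitely many cells; [reach] adjoins them to [A] while carrying [coh]
    along. *)
Lemma coh_all A n (G : {linear 'rV[S]_n -> F}) :
  (forall x, gen (fun=> True) x) -> hill_closed A -> fgs (fun c => gen A (G c)).
Proof.
move=> gen_all clA; have [T _ hT] := gen_fin_lin (fun c => gen_all (G c)).
have [B [clB [_ cohB] _ TB]] := reach coh_refl coh_trans coh_step T clA.
by apply: cohB => c; exact: gen_mono (hT c).
Qed.

End Coherent.
End Ranked.
End Span.

(** * Finitely generated kernels and preimages over a coherent ring *)

Section Coherence.
Variable S : pzRingType.

(** Comparison of two presentations, as in Schanuel's lemma: [c] in the kernel of [f] is
    [(c - b (a c)) + b (a c)], where [a c] is a relation of [g]. *)
Lemma finitely_presented_kernel (M : lmodType S) n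
    (f : {linear 'rV[S]_n -> M}) :
  finitely_presented M -> surjective f -> fgs (fun c => f c = 0).
Proof.
move=> [m [g [sur_g /fgs_kernel[p [G hG]]]]] sur_f.
have [a ha] := free_lift f sur_g; have [b hb] := free_lift g sur_f.
pose H : {linear 'rV[S]_(p + n) -> 'rV[S]_n} := GRing.add_fun
  (b \o G \o lsubmx) (GRing.sub_fun (@lin_id S _) (b \o a) \o rsubmx).
exists (p + n)%N, H => c; split=> [fc|[d <-]].
  have [d Gd] : exists d, G d = a c by apply/hG; rewrite ha.
  by exists (row_mx d c); rewrite /= row_mxKl row_mxKr Gd addrC subrK.
rewrite /= linearD linearB /= !hb ha subrr addr0.
by apply/hG; exists (lsubmx d).
Qed.

Hypothesis cohS : forall A : submodClosed S^o,
  finitely_generated (submod A) -> finitely_presented (submod A).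

Lemma coherent_kernel1 n (u : {linear 'rV[S]_n -> S^o}) :
  fgs (fun c => u c = 0).
Proof.
pose A := submod_of (issub_range u).
have [|v hv] := @factor_inj _ _ _ _ (submod_incl A) u (@submod_incl_inj _ _ A).
  move=> c; have h : u c \in A by apply/submod_ofP; exists c.
  by exists (Submod h).
have sur_v : surjective v.
  move=> y; have /submod_ofP[c uc] := valP y; exists c.
  by apply: val_inj; rewrite [LHS]hv uc.
have fpA : finitely_presented (submod A) by apply: cohS; exists n, v.
apply: fgs_ext (finitely_presented_kernel fpA sur_v) => c.
by rewrite -hv; split=> [->|e]; [rewrite linear0|apply: val_inj].
Qed.

(** One coordinate at a time: each new condition is imposed on generators of the kernel of the
    previous ones. *)
Lemma coherent_kernel n k (u : {linear 'rV[S]_n -> 'rV[S]_k}) :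
  fgs (fun c => u c = 0).
Proof.
suff h l : fgs (fun c => forall j : 'I_k, (j < l)%N -> u c 0 j = 0).
  apply: fgs_ext (h k) => c; split=> [uc|-> j _]; last by rewrite mxE.
  by apply/rowP => j; rewrite mxE uc.
elim: l => [|l [m [H hH]]]; first by apply: fgs_ext (fgs_true S n) => c.
have [lk|kl] := ltnP l k; last first.
  exists m, H => c; rewrite -hH.
  split=> h j jl; apply: h => //; first exact: ltnW.
  exact: leq_trans (ltn_ord j) kl.
pose e (x : 'rV[S]_k) : S^o := x 0 (Ordinal lk).
have le : linear e by move=> a x y; rewrite /e !mxE.
apply: fgs_ext (@fgs_comp _ _ _ H _ (fun c => e (u c) = 0) hH
  (coherent_kernel1 (mklin le \o u \o H))) => c.
rewrite /e; split=> [[h1 h2] j|h].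
  rewrite ltnS leq_eqVlt => /orP[/eqP jl|]; last exact: h1.
  by rewrite -[RHS]h2; congr (u c 0 _); apply: val_inj.
by split=> [j jl|]; apply: h => //=; exact: leqW.
Qed.

(** The preimage is the projection of the kernel of [(c, d) |-> u c - G d]. *)
Lemma coherent_preim n k (u : {linear 'rV[S]_n -> 'rV[S]_k}) L :
  fgs L -> fgs (fun c => L (u c)).
Proof.
move=> [m [G hG]].
pose w : {linear 'rV[S]_(n + m) -> 'rV[S]_k} :=
  GRing.sub_fun (u \o lsubmx) (G \o rsubmx).
have [p [K hK]] := coherent_kernel w.
exists p, (lsubmx \o K) => c; rewrite hG; split=> [[d Gd]|[d <-]].
  have [e Ke] : exists e, K e = row_mx c d.
    by apply/hK; rewrite /= row_mxKl row_mxKr Gd subrr.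
  by exists e; rewrite /= Ke row_mxKl.
exists (rsubmx (K d)); apply/esym/eqP; rewrite -subr_eq0; apply/eqP.
by apply/(hK (K d)); exists d.
Qed.

End Coherence.

(** * The small object argument *)

Section Attach.
Variables (S : pzRingType) (V A : lmodType S) (p : {linear V -> A}).

(** A lifting problem for [p] against the inclusion of the range of [sq_G]; [sq_ker] makes [sq_h]
    well defined on that range. *)
Record square := Square {
  sq_m : nat;
  sq_n : nat;
  sq_G : {linear 'rV[S]_sq_m -> 'rV[S]_sq_n};
  sq_h : {linear 'rV[S]_sq_m -> V};
  sq_g : {linear 'rV[S]_sq_n -> A};
  sq_ker : forall d, sq_G d = 0 -> sq_h d = 0;
  sq_comm : forall d, p (sq_h d) = sq_g (sq_G d) }.

(* The pushout of [V] along all the [im (sq_G i) -> 'rV_(sq_n i)].  By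
   [att_free], a cell meets the span of [V] and of the other cells only in
   [im (sq_G i)]. *)
Record attachment := Attachment {
  att_mod : lmodType S;
  att_proj : {linear att_mod -> A};
  att_in : {linear V -> att_mod};
  att_cell : forall i : square, {linear 'rV[S]_(sq_n i) -> att_mod};
  att_inj : injective att_in;
  att_projE : forall v, att_proj (att_in v) = p v;
  att_proj_cell : forall i c, att_proj (att_cell i c) = sq_g i c;
  att_glue : forall i d, att_cell i (sq_G i d) = att_in (sq_h i d);
  att_span : forall U : att_mod -> Prop, issub U -> (forall v, U (att_in v)) ->
    (forall i c, U (att_cell i c)) -> forall w, U w;
  att_free : forall i c, (forall U : att_mod -> Prop, issub U ->
      (forall v, U (att_in v)) ->
      (forall k d, k <> i -> U (att_cell k d)) -> U (att_cell i c)) ->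
    exists d, sq_G i d = c }.

(** The pushout is the quotient of [V * D] by the range of [Phi], whose components are the negated
    [sq_h] and the [sq_G]. *)
Lemma attachment_exists : inhabited attachment.
Proof.
pose D := dsum (fun i : square => 'rV[S]_(sq_n i)).
pose Phi1 : {linear dsum (fun i : square => 'rV[S]_(sq_m i)) -> V} :=
  dlift (fun i => GRing.opp_fun (sq_h i)).
pose Phi2 : {linear dsum (fun i : square => 'rV[S]_(sq_m i)) -> D} :=
  dlift (fun i => dinj (fun i : square => 'rV[S]_(sq_n i)) i \o sq_G i).
have Phi2E k y : dpr _ k (Phi2 y) = sq_G k (dpr _ k y).
  apply: (@dsum_span _ _ _ y (fun y => dpr _ k (Phi2 y) = sq_G k (dpr _ k y))).
    split=> [|a y1 y2 h1 h2]; first by rewrite !linear0.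
    by rewrite !linearP h1 h2.
  move=> i; rewrite /Phi2 dliftE /=; case: (pselect (i = k)) => [e|ik].
    by case: _ / e; rewrite !dpr_same.
  by rewrite !dpr_diff // linear0.
have Phi1_0 y : (forall k, sq_h k (dpr _ k y) = 0) -> Phi1 y = 0.
  move=> hy; apply: (@dsum_span _ _ _ y (fun y => Phi1 y = 0)).
    exact: (issub_preim Phi1 (issub_ker V)).
  by move=> i; rewrite /Phi1 dliftE /= hy oppr0.
pose Phi := pair_lin Phi1 Phi2.
have [W [q [sur_q ker_q]]] := quotient_exists (issub_range Phi).
pose gamma : {linear D -> A} := dlift sq_g.
have [|pr hpr] := @factor_surj _ _ _ _ q
    (GRing.add_fun (p \o @lin_fst S V D) (gamma \o @lin_snd S V D)) sur_q.
  move=> _ /ker_q[y <-] /=.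
  apply: (@dsum_span _ _ _ y (fun y => p (Phi1 y) + gamma (Phi2 y) = 0)).
    exact: (issub_preim (GRing.add_fun (p \o Phi1) (gamma \o Phi2))
      (issub_ker A)).
  move=> i; rewrite /Phi1 /Phi2 /gamma !dliftE /= ?dliftE linearN /= sq_comm.
  by rewrite addrC subrr.
pose incl : {linear V -> W} := q \o @pair_in S D V.
pose in2 : {linear D -> (V * D)%type} :=
  pair_lin (@lin_zero S D V) (@lin_id S D).
pose cell i : {linear 'rV[S]_(sq_n i) -> W} := q \o in2 \o dinj _ i.
have glue i d : cell i (sq_G i d) = incl (sq_h i d).
  apply/eqP; rewrite -subr_eq0 /= -linearB; apply/eqP/ker_q.
  exists (dinj _ i d); congr pair.
    by rewrite /= /Phi1 dliftE /= sub0r.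
  by rewrite /= /Phi2 dliftE /= subr0.
constructor; apply: (@Attachment W pr incl cell).
(* If [(v, 0)] is [Phi y], every [sq_G k] kills the component of [y], hence so does [sq_h k] by
   [sq_ker]. *)
- apply: linear_inj => v /ker_q[y [y1 y2]]; rewrite -y1; apply: Phi1_0 => k.
  by apply: sq_ker; rewrite -Phi2E y2 linear0.
- by move=> v; rewrite hpr /= linear0 addr0.
- by move=> i c; rewrite hpr /= linear0 add0r /gamma dliftE.
- exact: glue.
- move=> U hU Uin Ucell w; have [[v x] <-] := sur_q w.
  have -> : (v, x) = pair_in D v + in2 x.
    by congr pair; rewrite /= ?addr0 ?add0r.
  rewrite linearD; apply: (issubD hU) => //; first exact: Uin.
  by apply: (dsum_span (issub_preim (q \o in2) hU)) => i; exact: Ucell.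
- move=> i c h.
  (* The test submodule is the image of the pairs whose component at [i] lies in the range of
     [sq_G i]. *)
  have [] := h _ (issub_im q (issub_preim (dpr _ i \o @lin_snd S V D)
    (issub_range (sq_G i)))).
  + by move=> v; exists (pair_in D v) => //; exists 0; rewrite /= !linear0.
  + move=> k d ki; exists (in2 (dinj _ k d)) => //; exists 0.
    by rewrite /= dpr_diff // linear0.
  move=> vx [d hd] /eqP.
  rewrite eq_sym -subr_eq0 /= -linearB => /eqP/ker_q[y [_ y2]].
  exists (dpr _ i y + d).
  by rewrite linearD hd -Phi2E y2 /= linearB /= dpr_same subrK.
Qed.

End Attach.

(** * Iterated attachment of cells *)

Section Tower.
Variables (S : pzRingType) (V A : lmodType S) (p : {linear V -> A}).

(* [omega] steps are enough for [tw_lift], as a map from a finitely generated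
   module into the colimit factors through some stage. *)
Record tower := Tower {
  tw_mod : lmodType S;
  tw_proj : {linear tw_mod -> A};
  tw_in : {linear V -> tw_mod};
  tw_idx : eqType;
  tw_rk : tw_idx -> nat;
  tw_sz : tw_idx -> nat;
  tw_cell : forall i, {linear 'rV[S]_(tw_sz i) -> tw_mod};
  tw_inj : injective tw_in;
  tw_projE : forall v, tw_proj (tw_in v) = p v;
  tw_all : forall x, gen tw_cell (fun=> True) x;
  tw_base : forall x, gen tw_cell (fun i => (tw_rk i <= 0)%N) x <->
    exists v, tw_in v = x;
  tw_fgs : forall i, (0 < tw_rk i)%N ->
    fgs (fun c => gen tw_cell (lower tw_rk i) (tw_cell i c));
  tw_lower : forall i c, (0 < tw_rk i)%N ->
    gen tw_cell (fun j => j <> i /\ (tw_rk j <= tw_rk i)%N) (tw_cell i c) ->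
    gen tw_cell (lower tw_rk i) (tw_cell i c);
  tw_lift : forall m n (G : {linear 'rV[S]_m -> 'rV[S]_n})
    (h : {linear 'rV[S]_m -> tw_mod}) (g : {linear 'rV[S]_n -> A}),
    (forall d, G d = 0 -> h d = 0) -> (forall d, tw_proj (h d) = g (G d)) ->
    exists k : {linear 'rV[S]_n -> tw_mod},
      (forall d, k (G d) = h d) /\ forall c, tw_proj (k c) = g c }.

Definition attach (W : lmodType S) (r : {linear W -> A}) : attachment r :=
  inhabited_witness (attachment_exists r).

Definition next_stage (s : {W : lmodType S & {linear W -> A}}) :
    {W : lmodType S & {linear W -> A}} :=
  existT _ (att_mod (attach (projT2 s))) (att_proj (attach (projT2 s))).

Definition stage k := iter k next_stage (existT _ V p).
Definition stage_mod k := projT1 (stage k).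
Definition stage_proj k : {linear stage_mod k -> A} := projT2 (stage k).
Definition stage_att k : attachment (stage_proj k) := attach (stage_proj k).
Definition stage_in k : {linear stage_mod k -> stage_mod k.+1} :=
  att_in (stage_att k).

(** The tower is the colimit of the stages. By [genP] the cells of rank at most [k] span the image
    of stage [k], which turns the properties of each attachment into those of the tower. *)
Lemma tower_exists : inhabited tower.
Proof.
have [F [u [u_in u_inj u_sur]]] :=
  @colim_exists _ stage_mod stage_in (fun k => @att_inj _ _ _ _ (stage_att k)).
have u_mono k l (y : stage_mod k) : (k <= l)%N -> exists z : stage_mod l,
    u l z = u k y /\ stage_proj l z = stage_proj k y.
  move=> kl; rewrite -(subnK kl); elim: (_ - _)%N => [|d [z [<- <-]]].
    by exists y.
  exists (stage_in _ z); split; first exact: u_in.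
  exact: (att_projE (stage_att _)).
have [|||q hq] := @linear_of_rel _ F A
  (fun x a => exists k y, u k y = x /\ stage_proj k y = a).
- split; first by exists 0%N, 0; rewrite !linear0.
  move=> a _ _ _ _ [k [y [<- <-]]] [l [z [<- <-]]].
  have [y' [<- <-]] := u_mono _ _ y (leq_maxl k l).
  have [z' [<- <-]] := u_mono _ _ z (leq_maxr k l).
  by exists (maxn k l), (a *: y' + z'); rewrite !linearP.
- by move=> x; have [k [y <-]] := u_sur x; exists (stage_proj k y), k, y.
- move=> a [k [y [uy <-]]]; have -> : y = 0; last by rewrite linear0.
  by apply: (u_inj k); rewrite uy linear0.
have {}hq k y : q (u k y) = stage_proj k y.
  have [l [z [uz <-]]] := hq (u k y).
  have [y' [uy' <-]] := u_mono _ _ y (leq_maxl k l).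
  have [z' [uz' <-]] := u_mono _ _ z (leq_maxr k l).
  by congr (stage_proj _ _); apply: (u_inj (maxn k l)); rewrite uz' uz uy'.
(* Each element of [V] gives a cell of size [1] and rank [0]; each square of stage [k] gives a cell
   of rank [k.+1]. *)
pose I : eqType := {classic V + {k : nat & square (stage_proj k)}}.
pose rk (i : I) : nat := match i : V + {k : nat & square (stage_proj k)} with
  | inl _ => 0 | inr s => (projT1 s).+1 end.
pose sz (i : I) : nat := match i : V + {k : nat & square (stage_proj k)} with
  | inl _ => 1 | inr s => sq_n (projT2 s) end.
have scal_lin (v : V) : linear (fun c : 'rV[S]_1 => c 0 0 *: u 0%N v).
  by move=> a x y; rewrite !mxE scalerDl scalerA.
pose cell (i : I) : {linear 'rV[S]_(sz i) -> F} :=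
  match i as i0 return {linear 'rV[S]_(sz i0) -> F} with
  | inl v => mklin (scal_lin v)
  | inr s => u (projT1 s).+1 \o att_cell (stage_att (projT1 s)) (projT2 s) end.
have genP k x : gen cell (fun i => (rk i <= k)%N) x <-> exists y, u k y = x.
  split.
    move: x; apply: gen_ind; first exact: issub_range.
    case=> [v|s] c /= rs.
      have [y [uy _]] := u_mono 0%N k (c 0 0 *: v) isT; exists y.
      by rewrite uy linearZ.
    have [y [uy _]] := u_mono (projT1 s).+1 k
      (att_cell (stage_att (projT1 s)) (projT2 s) c) rs.
    by exists y.
  move=> [y <-]; elim: k y => [|k IH] y.
    have -> : u 0%N y = cell (inl y) (const_mx 1).
      by rewrite /= mxE scale1r.
    exact: gen_b.
  have hU := issub_preim (u k.+1) (gen_issub cell (fun i => (rk i <= k.+1)%N)).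
  apply: (att_span (a := stage_att k) hU) => [v|s c].
    by rewrite [u _ _]u_in; apply: gen_mono (IH v) => i; exact: leqW.
  have := @gen_b _ _ _ _ cell (fun i => (rk i <= k.+1)%N)
    (inr (existT _ k s)) c.
  by apply; rewrite /=.
have gen_all x : gen cell (fun=> True) x.
  have [k [y uy]] := u_sur x.
  apply: (@gen_mono _ _ _ _ cell (fun i => (rk i <= k)%N)) => //.
  by apply/genP; exists y.
constructor; apply: (@Tower F q (u 0%N) I rk sz cell).
- exact: (u_inj 0%N).
- exact: (hq 0%N).
- exact: gen_all.
- by move=> x; exact: (genP 0%N).
- case=> // -[k s] _; exists (sq_m s), (sq_G s) => c; split.
    move=> low; have [|y uy] := (genP k (cell (inr (existT _ k s)) c)).1 _.
      exact: low.
    apply: (@att_free _ _ _ _ (stage_att k)) => U hU Uin _.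
    have -> : att_cell (stage_att k) s c = att_in (stage_att k) y.
      by apply: (u_inj k.+1); rewrite [RHS]u_in uy.
    exact: Uin.
  move=> [d <-]; apply/(genP k); exists (sq_h s d).
  rewrite -u_in; congr (u _ _); apply/esym.
  exact: (att_glue (stage_att k)).
- case=> // -[k s] c _ high.
  suff [d <-] : exists d, sq_G s d = c.
    apply/(genP k); exists (sq_h s d).
    rewrite -u_in; congr (u _ _); apply/esym.
    exact: (att_glue (stage_att k)).
  apply: (@att_free _ _ _ _ (stage_att k)) => U hU Uin Ucell.
  (* [high] is applied to the image of [U]: it contains stage [k], hence all lower cells, and the
     other cells of rank [k.+1]. *)
  have [x Ux /u_inj <- //] : exists2 x, U x &
      u k.+1 x = u k.+1 (att_cell (stage_att k) s c).
  apply: (high (fun w => exists2 x, U x & u k.+1 x = w)); first exact: issub_im.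
  have base l (lk : (l <= k)%N) y : exists2 x, U x & u k.+1 x = u l y.
    have [z [<- _]] := u_mono l k y lk.
    by exists (stage_in k z); [exact: Uin|exact: u_in].
  case=> [v|[l s']] d [ne rl].
    have [x Ux ux] := base 0%N isT (d 0 0 *: v).
    by exists x; rewrite ?ux ?linearZ.
  move: rl ne; rewrite /= ltnS leq_eqVlt => /orP[/eqP e|lk].
    case: _ / (esym e) s' d => s' d ne.
    exists (att_cell (stage_att k) s' d) => //.
    by apply: Ucell => ss; apply: ne; rewrite ss.
  by move=> _; exact: base.
move=> m n G h g hG comm.
have [T _ hT] := gen_fin_lin (fun d => gen_all (h d)).
pose N := \max_(i <- T) rk i.
have hN d : exists y, u N y = h d.
  apply/genP; apply: gen_mono (hT d) => i iT; exact: leq_bigmax_seq.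
have [h' hh'] := factor_inj (u_inj N) hN.
have h'G d : G d = 0 -> h' d = 0.
  by move=> /hG hd; apply: (u_inj N); rewrite hh' hd linear0.
have h'comm d : stage_proj N (h' d) = g (G d) by rewrite -hq hh' comm.
(* The problem is itself a square of stage [N], so its own cell solves it. *)
pose s := Square h'G h'comm.
exists (u N.+1 \o att_cell (stage_att N) s); split=> [d|c] /=.
  rewrite -hh' -[RHS]u_in; congr (u _ _).
  exact: (@att_glue _ _ _ _ (stage_att N) s).
rewrite (hq N.+1); exact: (@att_proj_cell _ _ _ _ (stage_att N) s).
Qed.

End Tower.

(** * Periodic modules and cocycles *)

Section Periodicity.
Variable S : pzRingType.
Implicit Types V W X T J E P : lmodType S.

Lemma row0_eq (x y : 'rV[S]_0) : x = y.
Proof. by apply/rowP => -[]. Qed.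

(** Over the zero module, [tw_lift] is the extension criterion for fp-injectivity. *)
Lemma tower_fp_injective V (p : {linear V -> 'rV[S]_0}) (t : tower p) :
  fp_injective (tw_mod t).
Proof.
apply: fp_injective_crit => m n G h Gh.
have [|k [hk _]] := tw_lift (t := t) (g := @lin_zero _ _ _) Gh.
  by move=> d; exact: row0_eq.
by exists k.
Qed.

Lemma kernel_exact V W (f : {linear V -> W}) :
  surjective f -> short_exact (submod_incl (kernel f)) f.
Proof.
split=> [|x|//]; first exact: submod_incl_inj.
split=> [fx|[y <-]]; last exact/eqP/(valP y).
have h : x \in (kernel f : submodClosed V) by rewrite inE; apply/eqP.
by exists (Submod h).
Qed.

(* The kernel of ['rV_n -> P] is embedded in an fp-injective tower; its elements
   have rank 0 and lie in the span of a finite closed set of cells, hence in the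
   span of the finitely many cells of rank 0 among these. *)
Lemma fg_fp_projective P :
  finitely_generated P -> fp_projective P -> finitely_presented P.
Proof.
move=> [n [g sur_g]] fpP; exists n, g; split=> //.
have [t] := tower_exists (@lin_zero S (submod (kernel g)) 'rV[S]_0).
have [_ ker_g _] := kernel_exact sur_g.
have [|k hk] := ext_extend (h := tw_in t)
  (fpP _ (@tower_fp_injective _ _ t)) sur_g ker_g.
  by move=> x x0; rewrite (_ : x = 0) ?linear0 //; apply: val_inj.
have [T _ hT] := gen_fin_lin (fun c => tw_all (k c)).
have cl0 : hill_closed (tw_cell (t := t)) (tw_rk (t := t)) (fun=> False).
  by [].
have [B [clB _ [T' hT'] TB]] := reach (@tw_fgs _ _ _ _ t) (Q := fun _ _ => True)
  (fun _ => I) (fun _ _ _ _ _ => I) (fun _ _ _ _ _ => I) T cl0.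
pose T0 := [seq i <- T' | (tw_rk i <= 0)%N].
have [q [Z hZ]] := gen_basis (tw_cell (t := t)) T0.
have [|h hh] := factor_inj (@tw_inj _ _ _ _ t) (f := Z).
  move=> c; apply/tw_base; apply: (@gen_mono _ _ _ _ _ (fun i => i \in T0)).
    by move=> i; rewrite mem_filter => /andP[].
  by apply/hZ; exists c.
exists q, h => x; have [|c hc] := (hZ (tw_in t x)).1; last first.
  by exists c; apply: (@tw_inj _ _ _ _ t); rewrite hh.
have : gen (tw_cell (t := t)) (fun i => B i /\ (tw_rk i <= 0)%N) (tw_in t x).
  apply: (gen_cap (@tw_lower _ _ _ _ t)) => //.
    by rewrite -hk; apply: gen_mono (hT _) => i; exact: TB.
  by apply/tw_base; exists x.
apply: gen_mono => i [/hT'[//|iT'] ri]; by rewrite mem_filter ri.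
Qed.

(** * Families of short exact sequences linked by a bijective shift *)

Section PeriodicFamily.
Hypothesis periodic_fp_projective :
  forall M : lmodType S, periodic (@fp_projective S) M -> fp_projective M.

(** As [s] is bijective, the summed sequences begin and end with the same module [dsum X], of which
    each [X n] is a retract. *)
Lemma periodic_family (I : Type) (s : I -> I) (X Y : I -> lmodType S)
    (i : forall n, {linear X n -> Y n})
    (p : forall n, {linear Y n -> X (s n)}) :
  injective s -> surjective s -> (forall n, short_exact (i n) (p n)) ->
  (forall n, fp_projective (Y n)) -> forall n, fp_projective (X n).
Proof.
move=> inj_s sur_s ex fpY n.
pose i' : {linear dsum X -> dsum Y} := dlift (fun n => dinj Y n \o i n).
pose p' : {linear dsum Y -> dsum X} := dlift (fun n => dinj X (s n) \o p n).
have i'E k x : dpr Y k (i' x) = i k (dpr X k x).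
  apply: (@dsum_span _ _ _ x (fun x => dpr Y k (i' x) = i k (dpr X k x))).
    split=> [|a x1 x2 h1 h2]; first by rewrite !linear0.
    by rewrite !linearP h1 h2.
  move=> j; rewrite /i' dliftE /=; case: (pselect (j = k)) => [e|jk].
    by case: _ / e; rewrite !dpr_same.
  by rewrite !dpr_diff // linear0.
have p'E k y : dpr X (s k) (p' y) = p k (dpr Y k y).
  apply: (@dsum_span _ _ _ y (fun y => dpr X (s k) (p' y) = p k (dpr Y k y))).
    split=> [|a x1 x2 h1 h2]; first by rewrite !linear0.
    by rewrite !linearP h1 h2.
  move=> j; rewrite /p' dliftE /=; case: (pselect (j = k)) => [e|jk].
    by case: _ / e; rewrite !dpr_same.
  by rewrite !dpr_diff ?linear0 // => /inj_s.
apply: (fp_projective_retract (dpr_same (V := X) (i := n))).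
apply: periodic_fp_projective; exists (dsum Y), i', p'.
split; first exact: fp_projective_dsum.
split.
- apply: linear_inj => x x0; apply: dsum_eq => k; rewrite linear0.
  have [inj_i _ _] := ex k; apply: inj_i.
  by rewrite -i'E x0 !linear0.
- move=> y; split=> [y0|[x <-]].
    apply: (dsum_span (issub_range i')) => k; have [_ ker_p _] := ex k.
    have [|x ix] := (ker_p (dpr Y k y)).1; first by rewrite -p'E y0 linear0.
    by exists (dinj X k x); rewrite /i' dliftE /= ix.
  apply: dsum_eq => k; have [l <-] := sur_s k.
  rewrite p'E i'E linear0; have [_ ker_p _] := ex l.
  by apply/ker_p; eexists.
- move=> x; apply: (dsum_span (issub_range p')) => k; have [l e] := sur_s k.
  case: _ / e; have [_ _ /(_ (dpr X (s l) x))[y py]] := ex l.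
  by exists (dinj Y l y); rewrite /p' dliftE /= py.
Qed.

Record cover V := Cover {
  cov_ker : lmodType S;
  cov_mod : lmodType S;
  cov_in : {linear cov_ker -> cov_mod};
  cov_out : {linear cov_mod -> V};
  cov_exact : short_exact cov_in cov_out;
  cov_fp_projective : fp_projective cov_mod }.

Lemma cover_exists V : inhabited (cover V).
Proof.
have sl (v : V) : linear (fun a : S^o => (a : S) *: v).
  by move=> a x y; rewrite scalerDl scalerA.
pose f : {linear dsum (fun _ : V => S^o) -> V} := dlift (fun v => mklin (sl v)).
have sur_f : surjective f.
  move=> v; exists (dinj (fun _ => S^o) v 1).
  by rewrite /f dliftE mklinE scale1r.
constructor; apply: Cover (kernel_exact sur_f) _.
by apply: fp_projective_dsum => _; exact: fp_projective_regular.
Qed.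

Definition cover_of V : cover V := inhabited_witness (cover_exists V).

Lemma fp_projective0 : fp_projective 'rV[S]_0.
Proof.
apply: (@fp_projective_retract _ S^o _ (@lin_zero _ _ _) (@lin_zero _ _ _)).
  by move=> x; exact: row0_eq.
exact: fp_projective_regular.
Qed.

(** The given sequence is continued by covers of successive syzygies of [K] on one side, and by the
    identity of [T] and zero modules on the other; [periodic_family] applies. *)
Lemma fp_projective_kernel (K P T : lmodType S)
    (i : {linear K -> P}) (p : {linear P -> T}) :
  short_exact i p -> fp_projective P -> fp_projective T -> fp_projective K.
Proof.
move=> ex fpP fpT.
pose syz n := iter n (fun W => cov_ker (cover_of W)) K.
(* A resolution of [T], indexed by [nat + nat] so that the shift [s] towards [T]
   and then zeros is a bijection that computes. *)
pose X (k : nat + nat) : lmodType S :=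
  match k with inl n => syz n | inr 0 => T | inr _.+1 => 'rV[S]_0 end.
pose Y (k : nat + nat) : lmodType S := match k with
  | inl 0 => P | inl n.+1 => cov_mod (cover_of (syz n))
  | inr 0 => T | inr _.+1 => 'rV[S]_0 end.
pose s (k : nat + nat) : nat + nat := match k with
  | inl 0 => inr 0 | inl n.+1 => inl n | inr n => inr n.+1 end.
pose a k : {linear X k -> Y k} :=
  match k as k0 return {linear X k0 -> Y k0} with
  | inl 0 => i | inl n.+1 => cov_in (cover_of (syz n))
  | inr 0 => @lin_id S T | inr _.+1 => @lin_id S _ end.
pose b k : {linear Y k -> X (s k)} :=
  match k as k0 return {linear Y k0 -> X (s k0)} with
  | inl 0 => p | inl n.+1 => cov_out (cover_of (syz n))
  | inr 0 => @lin_zero S T _ | inr _.+1 => @lin_zero S _ _ end.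
apply: (@periodic_family _ s X Y a b _ _ _ _ (inl 0)).
- by case=> [[|n]|n] [[|m]|m] //= [->].
- case=> [n|[|n]]; [by exists (inl n.+1)|by exists (inl 0)|by exists (inr n)].
- case=> [[|n]|[|n]] //=; first exact: cov_exact.
    by split=> [x y //|x|y]; [split=> // _; exists x|exists 0; exact: row0_eq].
  by split=> [x y //|x|y]; [split=> // _; exists x|exists 0; exact: row0_eq].
- case=> [[|n]|[|n]] //=; try exact: fp_projective0.
  exact: cov_fp_projective.
Qed.

(** The quotient of [S] by [A] is finitely presented, so [A] is fp-projective as a kernel, and
    [fg_fp_projective] concludes. *)
Lemma coherent_of_periodic (A : submodClosed S^o) :
  finitely_generated (submod A) -> finitely_presented (submod A).
Proof.
move=> fgA; apply: fg_fp_projective => //.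
have [n [f sur_f]] := fgA.
have [T [q [sur_q ker_q]]] := quotient_exists (issub_range (submod_incl A)).
have ex : short_exact (submod_incl A) q.
  by split=> //; exact: submod_incl_inj.
apply: (fp_projective_kernel ex (@fp_projective_regular S)) => J.
apply: finitely_presented_fp_projective.
have l1 : linear (fun x : 'rV[S]_1 => x 0 0 : S^o).
  by move=> a x y; rewrite !mxE.
have l2 : linear (fun a : S^o => const_mx a : 'rV[S]_1).
  by move=> a x y; apply/rowP => j; rewrite !mxE.
exists 1%N, (q \o mklin l1); split=> [y|].
  by have [x <-] := sur_q y; exists (const_mx x); rewrite /= mxE.
apply/fgs_kernel; exists n, (mklin l2 \o submod_incl A \o f) => x; split.
  move=> /ker_q[y yx]; have [c fc] := sur_f y; exists c.
  by apply/rowP => j; rewrite ord1 /= fc mxE [LHS]yx.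
by move=> [d <-]; apply/ker_q; exists (f d); rewrite /= mxE.
Qed.

(** Acyclicity gives short exact sequences from the cocycles in degree [n] through [C n] to the
    cocycles in degree [n + 1], linked by a bijective shift. *)
Lemma cocycles_fp_projective (C : complex S) : acyclic C ->
  (forall n, fp_projective (C n)) -> forall n, fp_projective (cocycles C n).
Proof.
move=> acC fpC.
have d n : {p : {linear C n -> cocycles C (n + 1)} |
    forall x, submod_incl _ (p x) = cx_diff C n x}.
  apply: cid; apply: factor_inj; first exact: submod_incl_inj.
  move=> x; have h : cx_diff C n x \in
      (kernel (cx_diff C (n + 1)) : submodClosed (C (n + 1))).
    by rewrite inE cx_diff_diff.
  by exists (Submod h).
apply: (@periodic_family _ (fun n : int => n + 1) _ _
  (fun n => submod_incl (kernel (cx_diff C n))) (fun n => projT1 (d n))) => //.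
- exact: addIr.
- by move=> n; exists (n - 1); rewrite subrK.
move=> n; case: (d n) => p hp /=; split.
- exact: submod_incl_inj.
- move=> x; have -> : p x = 0 <-> cx_diff C n x = 0.
    by rewrite -hp; split=> [->|h]; [rewrite linear0|apply: val_inj].
  split=> [h|[y <-]]; last exact/eqP/(valP y).
  have hx : x \in (kernel (cx_diff C n) : submodClosed (C n)).
    by rewrite inE; apply/eqP.
  by exists (Submod hx).
- move=> y; have /eqP/acC[x hx] := valP y.
  by exists x; apply: val_inj; rewrite [LHS]hp.
Qed.

End PeriodicFamily.

(** In the constant complex on [N] with differential [i \o p], the cocycles are the image of [i], a
    copy of [M]. *)
Lemma periodic_of_cocycles :
  (forall C : complex S, acyclic C -> (forall n, fp_projective (C n)) ->
    forall n, fp_projective (cocycles C n)) ->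
  forall M : lmodType S, periodic (@fp_projective S) M -> fp_projective M.
Proof.
move=> H M [N [i [p [fpN [inj_i ker_p sur_p]]]]].
have pi x : p (i x) = 0 by apply/ker_p; exists x.
have dd (n : int) (x : N) : (i \o p) ((i \o p) x) = 0 by rewrite /= pi linear0.
pose C := @Complex S (fun=> N) (fun=> i \o p) dd.
have acC : acyclic C.
  move=> n x /= ipx.
  have /ker_p[a <-] : p x = 0 by apply: inj_i; rewrite ipx linear0.
  by have [y <-] := sur_p a; exists y.
have fpZ := H C acC (fun=> fpN) 0.
have [||s hs] := @factor_inj _ _ _ _ (submod_incl (kernel (cx_diff C 0))) i.
- exact: submod_incl_inj.
- move=> x; have h : i x \in (kernel (cx_diff C 0) : submodClosed N).
    by rewrite inE /= pi linear0.
  by exists (Submod h).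
have [|r hr] := @factor_inj _ _ _ _ i
  (submod_incl (kernel (cx_diff C 0))) inj_i.
  move=> x; apply/ker_p; apply: inj_i; rewrite linear0.
  exact/eqP/(valP x).
apply: (fp_projective_retract (s := s) (r := r)) fpZ.
by move=> x; apply: inj_i; rewrite hr hs.
Qed.

End Periodicity.

(** * Periodic modules over a coherent ring *)

Section PartialSections.
Variables (S : pzRingType) (J E M : lmodType S).
Variables (j : {linear J -> E}) (p : {linear E -> M}).
Hypotheses (ex : short_exact j p) (fpJ : fp_injective J).

(** Encodes a partial section of [p] by its image [Gr], its domain being the image of [Gr] under
    [p]. *)
Definition graph_inj (Gr : E -> Prop) := forall x, Gr x -> p x = 0 -> x = 0.

(** The obstruction to adding the generators [H] lives on the relations, parametrised by [G]: a lift
    [L] of [H] and the given section differ there by a map [h] to [J], which extends to the free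
    module because [J] is fp-injective. *)
Lemma extend_section (Gr : E -> Prop) q (H : {linear 'rV[S]_q -> M}) :
  issub Gr -> graph_inj Gr -> fgs (fun d => exists2 x, Gr x & p x = H d) ->
  exists Gr' : E -> Prop,
    [/\ issub Gr', (forall x, Gr x -> Gr' x), graph_inj Gr' &
      forall m, (exists2 x, Gr' x & p x = m) <->
                exists d, exists2 x, Gr x & p x = m - H d].
Proof.
have [inj_j ker_p sur_p] := ex.
move=> hGr injGr [m0 [G hG]].
have [L hL] := free_lift H sur_p.
have [||s hs] := @free_sel _ m0 _ (fun d x => Gr x /\ p x = H (G d)).
- split; first by split; [exact: issub0|rewrite !linear0].
  move=> a x x' y y' [? e1] [? e2]; split; first exact: hGr.2.
  by rewrite !linearP e1 e2.
- move=> d; have [|x Grx px] := (hG (G d)).2; first by exists d.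
  by exists x.
have [|h hh] := @factor_inj _ _ _ _ j (GRing.sub_fun (L \o G) s) inj_j.
  by move=> d; apply/ker_p; rewrite /= linearB /= hL (hs d).2 subrr.
have [|k hk] := fp_injective_extend (G := G) (h := h) fpJ.
  move=> d Gd; apply: inj_j; rewrite hh /= Gd !linear0.
  have [Gs ps] := hs d; rewrite (injGr _ Gs) ?subr0 //.
  by rewrite ps Gd linear0.
(* The corrected lift agrees with the section on all relations. *)
pose L' : {linear 'rV[S]_q -> E} := GRing.sub_fun L (j \o k).
have pL' d : p (L' d) = H d.
  by rewrite linearB hL /= (_ : p (j _) = 0) ?subr0 //; apply/ker_p; eexists.
exists (fun x => exists2 w, exists d, L' d = w & Gr (x - w)); split.
- exact: issub_add hGr (issub_range L').
- move=> x Grx; exists 0; last by rewrite subr0.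
  by exists 0; rewrite linear0.
(* Here [d] is a relation, so [L' d] lies in [Gr] and then so does [x]. *)
- move=> x [_ [d <-] Grx] px.
  have /hG[d' Gd'] : exists2 y, Gr y & p y = H d.
    exists (- (x - L' d)); first exact: issubN.
    by rewrite linearN linearB px pL' sub0r opprK.
  apply: injGr => //; rewrite -[x](subrK (L' d)); apply: issubD => //.
  rewrite -Gd' /= hk hh /= subKr.
  exact: (hs d').1.
- move=> m; split=> [[x [_ [d <-] Grx] px]|[d [x Grx px]]].
    by exists d; exists (x - L' d) => //; rewrite linearB px pL'.
  exists (x + L' d); last by rewrite linearD px pL' subrK.
  by exists (L' d); [exists d|rewrite addrK].
Qed.

End PartialSections.

(** * Closed sets of cells compatible with a periodicity sequence *)

Section Hill.
Variables (S : pzRingType) (I : eqType) (F : lmodType S) (sz : I -> nat).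
Variable b : forall i, {linear 'rV[S]_(sz i) -> F}.
Variable rk : I -> nat.
Hypothesis coherent : forall n k (u : {linear 'rV[S]_n -> 'rV[S]_k}) L,
  fgs L -> fgs (fun c => L (u c)).
Hypothesis b_all : forall x, gen b (fun=> True) x.
Hypothesis b_fgs : forall i, (0 < rk i)%N ->
  fgs (fun c => gen b (lower rk i) (b i c)).
Hypothesis b_lower : forall i c, (0 < rk i)%N ->
  gen b (fun j => j <> i /\ (rk j <= rk i)%N) (b i c) ->
  gen b (lower rk i) (b i c).
Hypothesis b_rk0 : forall i c, rk i = 0%N -> b i c = 0.

(** For an exact sequence given by [i : M -> N] and [p : N -> M], and a surjection [q : F -> N] with
    section [s], these maps will be [f = s \o i], [g = p \o q] and [e = s \o q]. The hypotheses
    express the exactness inside [F]. *)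
Variables (M : lmodType S) (f : {linear M -> F}) (g : {linear F -> M}).
Variable e : {linear F -> F}.
Hypothesis inj_f : injective f.
Hypothesis ef : forall m, e (f m) = f m.
Hypothesis gf : forall m, g (f m) = 0.
Hypothesis ker_g : forall x, g x = 0 -> exists m, f m = e x.
Hypothesis sur_g : surjective g.

Let gen_coh A n (G : {linear 'rV[S]_n -> F}) :
  hill_closed b rk A -> fgs (fun c => gen b A (G c)).
Proof. exact: (coh_all b_fgs b_lower coherent b_rk0 G b_all). Qed.

(* Identifying [M] with its image under [f], the trace of [gen A] on [M] is also
   the image of [gen A] under [g]. *)
Definition good (A : I -> Prop) := [/\ hill_closed b rk A,
  forall x, gen b A x -> gen b A (e x),
  forall x, gen b A x -> gen b A (f (g x))
  & forall m, gen b A (f m) -> exists2 x, gen b A x & g x = m].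

(** Modulo [gen A], elements of the trace are represented by the [c] with [Z c] in [gen A] plus the
    range of [f]. By [key] this means that [Z c - e (Z c)] and [f (g (Z c))] lie in [gen A], two
    conditions made finitely generated by [gen_coh]. *)
Lemma good_fg A B (T : seq I) : good A -> (forall i, B i <-> A i \/ i \in T) ->
  exists q (H : {linear 'rV[S]_q -> M}), forall m,
    gen b B (f m) <-> exists d, gen b A (f (m - H d)).
Proof.
move=> [clA eA fgA gA] BE; have hA := gen_issub b A.
have [n [Z hZ]] := gen_basis b T.
have [n1 [G1 hG1]] := gen_coh (GRing.sub_fun Z (e \o Z)) clA.
have [q [H0 hH0]] := @fgs_comp _ _ _ G1 _ (fun c => gen b A (f (g (Z c)))) hG1
  (gen_coh (f \o g \o Z \o G1) clA).
have key c : (exists m, gen b A (Z c - f m)) <-> exists d, H0 d = c.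
  rewrite -hH0 /=; split=> [[m hm]|[h1 h2]].
    have -> : Z c - e (Z c) = (Z c - f m) - e (Z c - f m).
      by rewrite linearB ef opprB addrA subrK.
    split; first by apply: (issubB hA) => //; exact: eA.
    by have := fgA _ hm; rewrite linearB gf subr0.
  (* [Z c = (Z c - e (Z c)) + e (Z c - y) + e y], where the middle term is in
     the image of [f] since [g] kills [Z c - y]. *)
  have [y Ay gy] := gA _ h2.
  have [|m fm] := ker_g (x := Z c - y); first by rewrite linearB gy subrr.
  exists m; rewrite fm linearB opprB addrCA; apply: (issubD hA) => //.
  exact: eA.
have [||H hH] := @free_sel _ q _ (fun d m => gen b A (Z (H0 d) - f m)).
- exact: (rel_linear_eq (Z \o H0) f hA).
- by move=> d; apply/key; exists d.
exists q, H => m; split=> [Bm|[d Am]].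
  have [c Ac] := gen_cup_seq BE hZ Bm.
  have [d Hd] : exists d, H0 d = c.
    by apply/key; exists m; rewrite -opprB; exact: (issubN hA).
  exists d; rewrite -Hd in Ac; rewrite linearB.
  have -> : f m - f (H d) = (f m - Z (H0 d)) + (Z (H0 d) - f (H d)).
    by rewrite addrA subrK.
  exact: (issubD hA).
have hB := gen_issub b B.
have AB x : gen b A x -> gen b B x by apply: gen_mono => i Ai; apply/BE; left.
rewrite -[m](subrK (H d)) linearD; apply: (issubD hB); first exact: AB.
rewrite -[f (H d)](subKr (Z (H0 d))); apply: (issubB hB); last exact: AB.
apply: (@gen_mono _ _ _ _ _ (fun i => i \in T)) => [i iT|].
  by apply/BE; right.
by apply/hZ; exists (H0 d).
Qed.

(** As [A] is good, only finitely many generators modulo [gen A] matter: [T1] and [T2] carry the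
    images of [Z] under [e] and [f \o g], and [T3] carries preimages under [g] of the generators
    [H]. *)
Lemma good_next A B (T : seq I) : good A -> hill_closed b rk B ->
  (forall i, B i <-> A i \/ i \in T) ->
  exists B' (T' : seq I), [/\ hill_closed b rk B',
    (forall i, B' i <-> A i \/ i \in T'), (forall i, B i -> B' i),
    (forall x, gen b B x -> gen b B' (e x) /\ gen b B' (f (g x)))
    & forall m, gen b B (f m) -> exists2 x, gen b B' x & g x = m].
Proof.
move=> goodA clB BE; have [clA eA fgA gA] := goodA.
have [n [Z hZ]] := gen_basis b T.
have [q [H hH]] := good_fg goodA BE.
have [K hK] := free_lift H sur_g.
have [T1 _ hT1] := gen_fin_lin (fun c => b_all ((e \o Z) c)).
have [T2 _ hT2] := gen_fin_lin (fun c => b_all ((f \o g \o Z) c)).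
have [T3 _ hT3] := gen_fin_lin (fun c => b_all (K c)).
have [B' [clB' BB' [T' hT'] TB']] := reach b_fgs
  (Q := fun A A' : I -> Prop => forall i, A i -> A' i) (fun _ _ => id)
  (fun _ _ _ h1 h2 i Ai => h2 i (h1 i Ai)) (fun _ _ _ _ _ _ => @or_introl _ _)
  (T1 ++ T2 ++ T3) clB.
have AB' x : gen b A x -> gen b B' x.
  by apply: gen_mono => i Ai; apply/BB'/BE; left.
have hB' := gen_issub b B'.
exists B', (T ++ T'); split=> //.
- by move=> i; rewrite hT' BE mem_cat; split=> [[[|]|]|[|/orP[]]]; intuition;
    right; apply/orP; intuition.
- move=> x Bx.
  have [c Ac] := gen_cup_seq BE hZ Bx.
  rewrite -[x](subrK (Z c)); move: (x - Z c) Ac => y Ay {Bx}.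
  rewrite !linearD; split; apply: (issubD hB').
  + by apply: AB'; exact: eA.
  + by apply: gen_mono (hT1 c) => i i1; apply: TB'; rewrite mem_cat i1.
  + by apply: AB'; exact: fgA.
  + by apply: gen_mono (hT2 c) => i i2; apply: TB'; rewrite !mem_cat i2 orbT.
- move=> m /hH[d /gA[x Ax gx]]; exists (x + K d); last first.
    by rewrite linearD gx hK subrK.
  apply: (issubD hB'); first exact: AB'.
  by apply: gen_mono (hT3 d) => i i3; apply: TB'; rewrite !mem_cat i3 !orbT.
Qed.

Variables (J E : lmodType S) (j : {linear J -> E}) (p : {linear E -> M}).
Hypotheses (ex : short_exact j p) (fpJ : fp_injective J).

(* [Gr] is the image of a section of [p] over [{m | gen A (f m)}]. *)
Definition sect (A : I -> Prop) (Gr : E -> Prop) :=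
  [/\ issub Gr, graph_inj p Gr &
      forall m, gen b A (f m) <-> exists2 x, Gr x & p x = m].

(** Goodness of [A] provides finitely many generators for the new part of the domain; closedness of
    [B] makes their relations finitely generated. *)
Lemma sect_grow A B B' Gr (T : seq I) : good A ->
  hill_closed b rk B -> sect B Gr -> (forall i, A i -> B i) ->
  (forall i, B i -> B' i) -> (forall i, B' i <-> A i \/ i \in T) ->
  exists2 Gr', sect B' Gr' & forall x, Gr x -> Gr' x.
Proof.
move=> goodA clB [hGr injGr GrB] AB BB' B'E.
have [q [H hH]] := good_fg goodA B'E.
have [|Gr' [hGr' GG' injGr' Gr'E]] := extend_section (H := H) ex fpJ hGr injGr.
  by apply: fgs_ext (gen_coh (f \o H) clB) => d; exact: GrB.
exists Gr' => //; split=> // m; rewrite Gr'E hH.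
split=> -[d hd]; last first.
  apply/hH; have /GrB Bm := hd; have hB' := gen_issub b B'.
  rewrite -[m](subrK (H d)) linearD; apply: (issubD hB').
    exact: gen_mono Bm.
  apply/hH; exists d; rewrite subrr linear0; exact: issub0 (gen_issub b A).
by exists d; apply/GrB; apply: gen_mono hd.
Qed.

(** Each closure condition may pass from one member to another, so this covers both the countable
    closing-off and chains in Zorn's lemma. *)
Lemma good_union (K : Type) (P : K -> I -> Prop) (Gr : K -> E -> Prop) : K ->
  (forall k l, exists m, [/\ forall i, P k i -> P m i, forall i, P l i -> P m i,
     forall x, Gr k x -> Gr m x & forall x, Gr l x -> Gr m x]) ->
  (forall k, hill_closed b rk (P k)) -> (forall k, sect (P k) (Gr k)) ->
  (forall k, exists l, (forall x, gen b (P k) x -> gen b (P l) (e x) /\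
     gen b (P l) (f (g x))) /\
     forall m, gen b (P k) (f m) -> exists2 x, gen b (P l) x & g x = m) ->
  good (fun i => exists k, P k i) /\
  sect (fun i => exists k, P k i) (fun x => exists k, Gr k x).
Proof.
move=> k0 dir cl sec st.
have PU k x : gen b (P k) x -> gen b (fun i => exists k, P k i) x.
  by apply: gen_mono => i; exists k.
have UP x : gen b (fun i => exists k, P k i) x -> exists k, gen b (P k) x.
  apply: gen_dir => // k l; have [m [km lm _ _]] := dir k l.
  by exists m.
split; split.
- exact: hill_closed_cup.
- move=> x /UP[k Px]; have [l [h _]] := st k.
  by have [? _] := h x Px; exact: (PU l).
- move=> x /UP[k Px]; have [l [h _]] := st k.
  by have [_ ?] := h x Px; exact: (PU l).
- move=> m /UP[k Pm]; have [l [_ h]] := st k; have [x Px gx] := h m Pm.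
  by exists x => //; exact: (PU l).
- split=> [|a x y [k Gx] [l Gy]].
    by exists k0; have [h _ _] := sec k0; exact: issub0 h.
  have [m [_ _ km lm]] := dir k l; exists m; have [h _ _] := sec m.
  by apply: h.2; [exact: km|exact: lm].
- by move=> x [k Gx]; have [_ h _] := sec k; exact: h.
- move=> m; split=> [/UP[k Pm]|[x [k Gx] px]].
    have [_ _ h] := sec k; have [x Gx px] := (h m).1 Pm.
    by exists x => //; exists k.
  by have [_ _ h] := sec k; apply: (PU k); apply/h; exists x.
Qed.

Lemma good_extend A Gr i : good A -> sect A Gr ->
  exists A' Gr', [/\ good A', sect A' Gr', forall k, A k -> A' k,
    (forall x, Gr x -> Gr' x) & A' i].
Proof.
move=> goodA secA; have [clA _ _ _] := goodA.
(* The stages stay finite over the fixed good set [A], though only their union is known to be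
   good. *)
pose ok (s : (I -> Prop) * (E -> Prop)) := [/\
  exists T : seq I, forall k, s.1 k <-> A k \/ k \in T, hill_closed b rk s.1 &
  sect s.1 s.2].
have step (s : {s | ok s}) : exists s' : {s | ok s},
    [/\ forall k, (sval s).1 k -> (sval s').1 k,
        forall x, (sval s).2 x -> (sval s').2 x,
        forall x, gen b (sval s).1 x -> gen b (sval s').1 (e x) /\
          gen b (sval s').1 (f (g x)) &
        forall m, gen b (sval s).1 (f m) ->
          exists2 x, gen b (sval s').1 x & g x = m].
  case: s => -[B G] [/= [T BE] clB secB].
  have [B' [T' [clB' B'E BB' h1 h2]]] := good_next goodA clB BE.
  have AB k : A k -> B k by move=> Ak; apply/BE; left.
  have [G' secB' GG'] := sect_grow goodA clB secB AB BB' B'E.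
  have okB' : ok (B', G') by split=> //; exists T'.
  by exists (exist _ (B', G') okB').
have [next hnext] := choice step.
have [B0 [clB0 AB0 [T0 B0E] iB0]] := reach b_fgs
  (Q := fun A A' : I -> Prop => forall i, A i -> A' i) (fun _ _ => id)
  (fun _ _ _ h1 h2 i Ai => h2 i (h1 i Ai)) (fun _ _ _ _ _ _ => @or_introl _ _)
  [:: i] clA.
have [G0 secB0 GG0] := sect_grow goodA clA secA (fun _ => id) AB0 B0E.
have ok0 : ok (B0, G0) by split=> //; exists T0.
pose s k := iter k next (exist _ (B0, G0) ok0).
have mono k l : (k <= l)%N ->
    (forall i, (sval (s k)).1 i -> (sval (s l)).1 i) /\
    forall x, (sval (s k)).2 x -> (sval (s l)).2 x.
  move=> kl; rewrite -(subnK kl); elim: (_ - _)%N => [//|d [h1 h2]].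
  have [n1 n2 _ _] := hnext (s (d + k)%N).
  by split=> [y /h1 /n1|y /h2 /n2].
have [||||goodU secU] := @good_union nat (fun k => (sval (s k)).1)
  (fun k => (sval (s k)).2) 0%N.
- move=> k l; exists (maxn k l).
  have [? ?] := mono _ _ (leq_maxl k l); have [? ?] := mono _ _ (leq_maxr k l).
  by [].
- by move=> k; have [] := projT2 (s k).
- by move=> k; have [] := projT2 (s k).
- by move=> k; exists k.+1; have [_ _ ? ?] := hnext (s k).
exists (fun i => exists k, (sval (s k)).1 i),
  (fun x => exists k, (sval (s k)).2 x).
split=> //.
- by move=> k Ak; exists 0%N; exact: AB0.
- by move=> x Gx; exists 0%N; exact: GG0.
- by exists 0%N; apply: iB0; rewrite inE.
Qed.

Lemma hill_section : exists s : {linear M -> E}, forall m, p (s m) = m.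
Proof.
pose ok (s : (I -> Prop) * (E -> Prop)) := good s.1 /\ sect s.1 s.2.
pose R (s t : {s | ok s}) := `[< (forall i, (sval s).1 i -> (sval t).1 i) /\
  forall x, (sval s).2 x -> (sval t).2 x >].
have gen0 x : gen b (fun=> False) x -> x = 0.
  by move: x; apply: gen_ind => //; exact: issub_ker.
have ok0 : ok (fun=> False, fun x => x = 0).
  have h0 := issub0 (gen_issub b (fun=> False)).
  split; split=> //=.
  - by move=> x /gen0->; rewrite linear0.
  - by move=> x /gen0->; rewrite !linear0.
  - move=> m /gen0 fm; exists 0 => //.
    by rewrite linear0; apply: inj_f; rewrite linear0 fm.
  - exact: issub_ker.
  - move=> m; split=> [/gen0 fm|[x -> <-]]; last by rewrite !linear0.
    by exists 0 => //; rewrite linear0; apply: inj_f; rewrite linear0 fm.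
have [|||[[A Gr] okA] maxA] := @ZL_preorder _ (exist _ _ ok0 : {s | ok s}) R.
- by move=> s; apply/asboolP.
- move=> s t r /asboolP[h1 h2] /asboolP[h3 h4]; apply/asboolP.
  by split=> [i /h1 /h3|x /h2 /h4].
- move=> C totC.
  (* [good_union] requires an inhabited family; the empty chain is bounded by the zero section. *)
  have [[c0 Cc0]|noC] := EM (exists c, C c); last first.
    by exists (exist _ _ ok0) => s Cs; case: noC; exists s.
  have [||||okU secU] := @good_union {c | C c} (fun c => (sval (sval c)).1)
    (fun c => (sval (sval c)).2) (exist _ c0 Cc0).
  + move=> [c Cc] [d Cd] /=.
    have [/asboolP[h1 h2]|/asboolP[h1 h2]] := totC c d Cc Cd.
      by exists (exist _ d Cd).
    by exists (exist _ c Cc).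
  + by move=> c; have [[? _ _ _] _] := svalP (sval c).
  + by move=> c; have [_ ?] := svalP (sval c).
  + move=> c; exists c; have [[_ e1 fg1 g1] _] := svalP (sval c).
    by split=> // x cx; split; [exact: e1|exact: fg1].
  exists (exist _ (fun i => exists c : {c | C c}, (sval (sval c)).1 i,
    fun x => exists c : {c | C c}, (sval (sval c)).2 x) (conj okU secU)).
  move=> s Cs; apply/asboolP.
  by split=> [i si|x sx]; exists (exist _ s Cs).
have [goodA secA] := okA.
(* Otherwise [good_extend] would contradict maximality. *)
have allA i : A i.
  have [A' [Gr' [goodA' secA' AA' GG' A'i]]] := good_extend i goodA secA.
  have /asboolP[h _] := maxA (exist _ (A', Gr') (conj goodA' secA'))
    (introT (asboolP _) (conj AA' GG')).
  exact: h.
have [hGr injGr GrA] := secA.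
have [|||s hs] := @linear_of_rel _ M E (fun m x => Gr x /\ p x = m).
- split; first by split; [exact: issub0 hGr|rewrite linear0].
  move=> a m m' x x' [? <-] [? <-]; split; first exact: hGr.2.
  by rewrite linearP.
- move=> m; have [|x Gx px] := (GrA m).1; last by exists x.
  by apply: gen_mono (b_all _) => i _; exact: allA.
- by move=> x [Gx px]; exact: injGr.
by exists s => m; have [] := hs m.
Qed.

End Hill.

Lemma coherent_periodic (S : pzRingType) :
  (forall A : submodClosed S^o,
    finitely_generated (submod A) -> finitely_presented (submod A)) ->
  forall M : lmodType S, periodic (@fp_projective S) M -> fp_projective M.
Proof.
move=> cohS M [N [i [p [fpN [inj_i ker_p sur_p]]]]].
have [t] := tower_exists (@lin_zero S 'rV[S]_0 N).
pose q := tw_proj t.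
have sur_q : surjective q.
  move=> y; have ly : linear (fun c : 'rV[S]_1 => c 0 0 *: y).
    by move=> a u v; rewrite !mxE scalerDl scalerA.
  (* A lifting problem with empty relations: the generator of the free module of rank one is sent to
     [y]. *)
  have [d _|d|k [_ hk]] := tw_lift (t := t) (G := @lin_zero S 'rV[S]_0 'rV[S]_1)
    (h := @lin_zero S _ _) (g := mklin ly).
  - by [].
  - by rewrite /= linear0 mxE scale0r.
  by exists (k (const_mx 1)); rewrite hk mklinE mxE scale1r.
(* A lifting problem over the zero map to [N] has its solution inside the kernel of [q]. *)
have fpK : fp_injective (submod (kernel q)).
  apply: fp_injective_crit => m n G h Gh.
  have [d Gd|d|k [hk qk]] := tw_lift (t := t) (G := G)
    (h := submod_incl (kernel q) \o h) (g := @lin_zero S _ _).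
  - by rewrite /= Gh // linear0.
  - exact/eqP/(valP (h d)).
  have [||k' hk'] := @factor_inj _ _ _ _ (submod_incl (kernel q)) k.
  - exact: submod_incl_inj.
  - move=> c; have kc : k c \in (kernel q : submodClosed _).
      by rewrite inE; apply/eqP; exact: qk.
    by exists (Submod kc).
  by exists k' => d; apply: val_inj; rewrite [LHS]hk' hk.
(* Since [N] is fp-projective, [q] splits and [N] is a retract of the tower. *)
have [s hs] := ext_lift (@lin_id S N) (fpN _ fpK) (kernel_exact sur_q).
move=> J fpJ; apply: ext_split => E j r ex.
apply: (hill_section (b := tw_cell (t := t)) (rk := tw_rk (t := t))
  (coherent_preim cohS) (f := s \o i) (g := p \o q) (e := s \o q)
  _ _ _ _ _ _ _ _ _ ex fpJ).
- exact: tw_all.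
- exact: tw_fgs.
- exact: tw_lower.
(* The tower starts from the zero module, so cells of rank [0] vanish. *)
- move=> k c k0; have [v <-] : exists v, tw_in t v = tw_cell k c.
    by apply/tw_base; apply: gen_b; rewrite k0.
  by rewrite (row0_eq v 0) linear0.
- move=> x y /= sxy; apply: inj_i; by rewrite -[i x]hs sxy hs.
- by move=> m /=; rewrite hs.
- by move=> m /=; rewrite hs; apply/ker_p; exists m.
- by move=> x /= /ker_p[m <-]; exists m.
- by move=> m; have [y <-] := sur_p m; have [x <-] := sur_q y; exists x.
Qed.

Theorem corollary4p10 (R : pzRingType) :
  let cond1 :=
    forall C : complex R^c, acyclic C ->
      (forall n : int, fp_projective (C n)) ->
      forall n : int, fp_projective (cocycles C n) in
  let cond2 :=
    forall M : lmodType R^c,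
      periodic (@fp_projective R^c) M -> fp_projective M in
  let cond3 := right_coherent R in
  (cond1 <-> cond2) /\ (cond2 <-> cond3).
Proof.
move=> cond1 cond2 cond3; split; split.
- exact: periodic_of_cocycles.
- by move=> h C; exact: cocycles_fp_projective.
- by move=> h A; exact: coherent_of_periodic.
- exact: coherent_periodic.
Qed.
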